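(* Let $K\subseteq\mathbb{R}^n$ be a convex body with $0\in P_{e_n^\perp}(K)$. Assume that $$\max_{y\in P_{e_n^\perp}(K)\cap\mathbb{Z}^n}G_1(S_{e_n}(K)\cap(y+\langle e_n\rangle))=G_1(S_{e_n}(K)\cap\langle e_n\rangle).$$ Then there exists a real number $m_0\geq M:=\max_{x\in S_{e_n}(K)\cap\mathbb{Z}^n}\langle x,e_n\rangle$ such that $m_0>1$ and $$\frac{(n+1)\,B_{m_0}(n+1)^{-1}}{B_{m_0}(1)^{-(n+1)}}\,2^n\int_{S_{e_n}(K)}|\langle x,e_n\rangle|^n\,dG_n(x)\leq\frac{\left(G_n(S_{e_n}(K)+C_{n-1})+G_{n-1}(P_{e_n^\perp}(K)+C_{n-1})\right)^{n+1}}{\big(G_{n-1}(P_{e_n^\perp}(K))\big)^n}.$$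
   Context: For real $m>0$ and $p\geq1$, $$B_{m}(p)=\sum_{k=0}^{\lfloor m\rfloor}\frac{p}{m}\left(1-\frac{k}{m}\right)^{n-1}\left(\frac{k}{m}\right)^{p-1},$$ with the convention $0^0=1$. A convex body is a compact convex set with non-empty interior. $(e_i)_{i=1}^n$ is the canonical orthonormal basis of $\mathbb{R}^n$, $\langle e_n\rangle$ is the line spanned by $e_n$, $\langle x,e_n\rangle$ is the Euclidean inner product, $e_n^\perp$ is the linear hyperplane orthogonal to $e_n$ (identified with $\mathbb{R}^{n-1}$), and $P_{e_n^\perp}$ is the orthogonal projection onto $e_n^\perp$. $G_n(A)=|A\cap\mathbb{Z}^n|$ for $A\subseteq\mathbb{R}^n$, and $dG_n$ denotes the corresponding counting measure on $\mathbb{Z}^n$, so $\int_A h\,dG_n=\sum_{x\in A\cap\mathbb{Z}^n}h(x)$. For $A\subseteq e_n^\perp$, $G_{n-1}(A)=|A\cap\mathbb{Z}^n|$; for $y\in e_n^\perp\cap\mathbb{Z}^n$ and $A\subseteq y+\langle e_n\rangle$, $G_1(A)=|A\cap\mathbb{Z}^n|$. $C_{n-1}=(-1,1)^{n-1}\times\{0\}\subseteq\mathbb{R}^n$, and $+$ between sets is the Minkowski sum. $S_{e_n}(K)$ is the Steiner symmetrization of $K$ with respect to $e_n^\perp$; for compact $K$, $S_{e_n}(K)=\{(y,t)\in\mathbb{R}^{n-1}\times\mathbb{R}: y\in P_{e_n^\perp}(K),\ |t|\leq\tfrac12\mathrm{vol}_1(K\cap(y+\langle e_n\rangle))\}$,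 where $\mathrm{vol}_1$ is 1-dimensional Lebesgue measure. *)

(* Defs.v *)
From HB Require Import structures.
From mathcomp Require Export all_boot all_order all_algebra.
From mathcomp Require Export finmap.
From mathcomp Require Export all_classical all_reals all_analysis.

Export Order.TTheory GRing.Theory Num.Theory.
Export numFieldNormedType.Exports.

Set Implicit Arguments.
Unset Strict Implicit.
Unset Printing Implicit Defensive.

#[export] Set Implicit Arguments.
#[export] Unset Strict Implicit.
#[export] Unset Printing Implicit Defensive.

Local Open Scope classical_set_scope.
Local Open Scope ring_scope.

(* The dimension is n.+1, so that the last basis vector exists; R^n is
   identified with the hyperplane of R^(n+1) orthogonal to that vector. *)

Definition inner (R : realType) (n : nat) (x y : 'rV[R]_n) : R :=
  \sum_i x 0 i * y 0 i.

Definition e_last (R : realType) (n : nat) : 'rV[R]_n.+1 :=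
  delta_mx 0 ord_max.

Definition axis (R : realType) (n : nat) : set 'rV[R]_n.+1 :=
  [set t *: e_last R n | t in [set: R]].
Arguments axis : clear implicits.

Definition proj (R : realType) (n : nat) (x : 'rV[R]_n.+1) : 'rV[R]_n.+1 :=
  x - inner x (e_last R n) *: e_last R n.
Arguments proj {R n} x.

Definition minkowski_sum (R : realType) (n : nat) (A B : set 'rV[R]_n) :
    set 'rV[R]_n :=
  [set x + y | x in A & y in B].

Definition fiber (R : realType) (n : nat) (y : 'rV[R]_n.+1) :
    set 'rV[R]_n.+1 :=
  [set y + z | z in axis R n].

Definition convex_body (R : realType) (n : nat) (K : set 'rV[R]_n.+1) : Prop :=
  [/\ compact K, convex_set K & K^° !=set0].

Definition lattice (R : realType) (n : nat) : set 'rV[R]_n :=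
  [set x | forall i, x 0 i \is a Num.int].
Arguments lattice : clear implicits.

(* Number of lattice points. [fset_set] returns the empty set on infinite sets,
   so this is the cardinality only for sets with finitely many lattice points,
   in particular for all bounded sets. The same function counts lattice points
   of subsets of the hyperplane and of the fibers, where it plays the role of
   the lower-dimensional enumerators. *)
Definition G (R : realType) (n : nat) (A : set 'rV[R]_n) : nat :=
  #|` fset_set (A `&` lattice R n)|.

(* Integral against the lattice counting measure; [\sum_(x \in _)] is the sum
   over the support, and is 0 by convention when the support is infinite. *)
Definition lattice_integral (R : realType) (n : nat) (A : set 'rV[R]_n)
    (h : 'rV[R]_n -> R) : R :=
  \sum_(x \in A `&` lattice R n) h x.

Definition cube (R : realType) (n : nat) : set 'rV[R]_n.+1 :=
  [set x | (forall i, i != ord_max -> -1 < x 0 i < 1) /\ x 0 ord_max = 0].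
Arguments cube : clear implicits.

(* One-dimensional volume of a subset of a fiber: the map x |-> <x, e_last> is
   an isometry from each fiber onto the real line. *)
Definition vol1 (R : realType) (n : nat) (A : set 'rV[R]_n.+1) : \bar R :=
  lebesgue_measure [set inner x (e_last R n) | x in A].

(* A point (y, t) of R^n * R is represented by x with proj x = y and
   inner x e_last = t. *)
Definition steiner (R : realType) (n : nat) (K : set 'rV[R]_n.+1) :
    set 'rV[R]_n.+1 :=
  [set x | (proj @` K) (proj x) /\
    ((`|inner x (e_last R n)|)%:E <=
       (2^-1)%:E * vol1 (K `&` fiber (proj x)))%E].

Definition is_max (d : Order.disp_t) (T : porderType d) (A : set T) (m : T) :
    Prop :=
  A m /\ ubound A m.

(* In dimension n. Both [^+] and [`^] satisfy 0 to the 0 = 1; the base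
   1 - k / m is nonnegative, as k <= m. *)
Definition B (R : realType) (n : nat) (m p : R) : R :=
  \sum_(0 <= k < (Num.truncn m).+1)
    p / m * (1 - k%:R / m) ^+ n.-1 * (k%:R / m) `^ (p - 1).

(* Main.v *)
Require Import Defs.
From mathcomp Require Import measurable_realfun zify lra ring.

(** Write S for the Steiner symmetral of K, C for the flat cube, and N = n + 1
for the dimension.  The proof looks at S through its slices at integer heights
k: let g(k) be the number of lattice points of the slice of S, and gC(k) that
of the slice of S + C.

Both sides of the inequality are sums over slices.  As S is symmetric about the
hyperplane, the integral is twice the sum of k^N g(k), and the bracket on the
right is at least twice the sum of the gC(k), because the enumerator of the
projection doubles the slice at height 0.  The sums stop at the height M of the
topmost lattice point of the central fiber: a lattice point of S at a greater
height would lie on a fiber with more lattice points than the central one.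
The factors B are the moments sum_{k <= m} (1 - k/m)^n k^p of a cone of height
m, up to normalization.  After cancellation it suffices to find m >= M, m > 1,
such that the cone of height m with base g(0) has an N-th moment at least that
of g and a total mass at most that of gC (exists_threshold).

This is the crossing argument behind the inequality of Berwald.  If the cone of
height M has a large enough moment, m = M will do.  Otherwise, by continuity,
some cone has exactly the N-th moment of g.  Let k1 be the last level at which
g is not below the cone.  The Brunn-Minkowski inequality between the slices at
heights 0 and k1 puts gC above the cone at all levels up to k1; beyond k1, g is
below the cone.  So the function that is gC up to k1 and g beyond it crosses the
cone only once, its N-th moment is at least that of the cone, and comparing the
weights k^N with k1^N yields the same inequality for the masses.

The Brunn-Minkowski inequality needed is the one for lattice points: if A and B
are finite sets of integer points, the integer points at sup-distance less than
1 from a mean (1 - lam) a + lam b number at least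
((1 - lam) |A|^(1/d) + lam |B|^(1/d))^d (brunn_minkowski_lattice).  It follows
by induction on d from a one-dimensional functional inequality, whose level
sets are treated by a direct count on the integers. *)

Local Open Scope fset_scope.
Local Open Scope ring_scope.

(** * Inequalities between real numbers *)

(** The inequality between the arithmetic and geometric means of one x and d
copies of y, which is also the homogeneous form of the Bernoulli inequality. *)
Lemma bernoulli_homogeneous (R : realDomainType) d (x y : R) :
  0 <= x -> 0 <= y -> d.+1%:R * x * y ^+ d <= x ^+ d.+1 + d%:R * y ^+ d.+1.
Proof.
move=> x0 y0; elim: d => [|d ih]; first by rewrite !expr0 expr1; lra.
have h : 0 <= (x ^+ d.+1 - y ^+ d.+1) * (x - y).
  have [xy|/ltW yx] := lerP x y.
    by apply: mulr_le0; rewrite subr_le0 ?lerXn2r.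
  by apply: mulr_ge0; rewrite subr_ge0 ?lerXn2r.
have := ler_wpM2l y0 ih.
rewrite -[d.+2%:R]natr1 -[d.+1%:R]natr1 !(exprS _ d.+1) !(exprS _ d) in h *.
by rewrite !exprS in ih *; nra.
Qed.

(** A Hoelder inequality for means with two terms.  By the inequality above,
w^(d+1) / v^d is the maximum over s >= 0 of the linear forms
(d+1) s^d w - d s^(d+1) v.  Averaging these bounds, with the s that is optimal
for the means of w and v, gives the claim. *)
Lemma holder_mean (R : realFieldType) d (lam u1 u2 v1 v2 w1 w2 : R) :
  0 <= lam <= 1 -> 0 < v1 -> 0 < v2 -> 0 <= w1 -> 0 <= w2 ->
  w1 ^+ d.+1 <= u1 * v1 ^+ d -> w2 ^+ d.+1 <= u2 * v2 ^+ d ->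
  ((1 - lam) * w1 + lam * w2) ^+ d.+1 <=
  ((1 - lam) * u1 + lam * u2) * ((1 - lam) * v1 + lam * v2) ^+ d.
Proof.
move=> /andP[l0 l1] v1p v2p w1p w2p h1 h2.
set W := _ + lam * w2; set V := (_ + lam * v2).
have l1' : 0 <= 1 - lam by rewrite subr_ge0.
have V0 : 0 < V.
  rewrite /V; have [->|ln] := eqVneq lam 0; first by rewrite subr0 mul1r mul0r addr0.
  have lp : 0 < lam by rewrite lt0r ln.
  by apply: ltr_wpDl; [exact: mulr_ge0 l1' (ltW v1p)|exact: mulr_gt0].
have W0 : 0 <= W by rewrite addr_ge0 ?mulr_ge0.
(* the slope of the tangent form that is optimal for the means W and V *)
pose s := W / V.
have s0 : 0 <= s by rewrite divr_ge0 // ltW.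
have tangent w v u : 0 <= w -> 0 < v -> w ^+ d.+1 <= u * v ^+ d ->
    d.+1%:R * s ^+ d * w - d%:R * s ^+ d.+1 * v <= u.
  move=> w0 v0 h.
  have vd : 0 < v ^+ d by rewrite exprn_gt0.
  rewrite -(ler_pM2r vd); apply: le_trans h.
  have := bernoulli_homogeneous d w0 (mulr_ge0 s0 (ltW v0)).
  rewrite !exprMn !exprS => h.
  rewrite -subr_ge0 in h; rewrite -subr_ge0; apply: le_trans h _.
  by rewrite le_eqVlt; apply/orP; left; apply/eqP; ring.
have /(ler_wpM2l l1') t1 := tangent _ _ _ w1p v1p h1.
have /(ler_wpM2l l0) t2 := tangent _ _ _ w2p v2p h2.
have Vd : 0 < V ^+ d by rewrite exprn_gt0.
have sV : s ^+ d.+1 * V = s ^+ d * W by rewrite exprS /s; field; exact: lt0r_neq0.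
have -> : W ^+ d.+1 = s ^+ d * W * V ^+ d.
  by rewrite exprSr /s expr_div_n mulrAC divfK ?lt0r_neq0.
rewrite ler_pM2r //; apply: le_trans (lerD t1 t2).
have -> : (1 - lam) * (d.+1%:R * s ^+ d * w1 - d%:R * s ^+ d.+1 * v1) +
    lam * (d.+1%:R * s ^+ d * w2 - d%:R * s ^+ d.+1 * v2) =
    d.+1%:R * s ^+ d * W - d%:R * (s ^+ d.+1 * V).
  by rewrite /W /V; ring.
by rewrite sV -natr1 mulrDl mul1r mulrDl -mulrA addrAC subrr add0r.
Qed.

Lemma has_argmin (R : realDomainType) (T : eqType) (P : pred T) (x : T -> R) s :
  has P s -> exists m, [/\ m \in s, P m &
    forall k, k \in s -> P k -> x m <= x k].
Proof.
elim: s => // a s ih /=; have [/ih [m [ms Pm mmin]] _|/hasPn no] := boolP (has P s).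
  have [Pa|nPa] := boolP (P a); last first.
    exists m; split=> [||k]; rewrite ?inE ?ms ?orbT //.
    by move=> /predU1P[->|/mmin //]; rewrite (negPf nPa).
  have [am|/ltW ma] := lerP (x a) (x m).
    exists a; split=> [||k]; rewrite ?inE ?eqxx //.
    by move=> /predU1P[->//|ks /(mmin _ ks)]; exact: le_trans.
  exists m; split=> [||k]; rewrite ?inE ?ms ?orbT //.
  by move=> /predU1P[->//|/mmin].
rewrite orbF => Pa; exists a; split=> [||k]; rewrite ?inE ?eqxx //.
by move=> /predU1P[->//|/no /negPf ->].
Qed.

(** A sum is the integral over t > 0 of its level sets, so positivity passes from
the level sets to the sum.  With finitely many values no integral is required:
subtracting the least positive value from all the positive ones removes a
nonnegative layer and a positive value. *)
Lemma layer_cake_ge0 (R : realDomainType) (T : eqType) (s : seq T) (w x : T -> R) :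
  (forall k, k \in s -> 0 <= x k) ->
  (forall t, 0 < t -> 0 <= \sum_(k <- s | t <= x k) w k) ->
  0 <= \sum_(k <- s) w k * x k.
Proof.
have [p] := ubnP (count (fun k => 0 < x k) s).
elim: p x => // p ih x cp x0 h.
have [hasx|/hasPn no] := boolP (has (fun k => 0 < x k) s); last first.
  rewrite big_seq big1 // => k ks.
  by have := no k ks; rewrite lt_neqAle x0 // andbT negbK => /eqP <-; rewrite mulr0.
have [m [ms xm mmin]] := has_argmin x hasx.
pose x' k := Num.max (x k - x m) 0.
have -> : \sum_(k <- s) w k * x k =
    x m * \sum_(k <- s | x m <= x k) w k + \sum_(k <- s) w k * x' k.
  rewrite [X in _ = _ * X + _]big_mkcond mulr_sumr -big_split /= big_seq [RHS]big_seq.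
  apply: eq_bigr => k ks; rewrite /x'; case: lerP => [le|lt].
    by rewrite max_l ?subr_ge0 //; ring.
  rewrite max_r ?subr_le0 ?(ltW lt) // !mulr0 addr0.
  suff -> : x k = 0 by rewrite mulr0.
  apply/eqP; rewrite eq_le x0 // andbT leNgt; apply/negP => /(mmin _ ks).
  by rewrite leNgt lt.
rewrite addr_ge0 ?mulr_ge0 ?h // ?(ltW xm) //; apply: ih.
- have m1 : (0 < count (pred1 m) s)%N by rewrite -has_count has_pred1.
  rewrite -ltnS; apply: leq_trans cp; rewrite ltnS.
  have : (count (fun k => (0 < x' k)%R) s + count (pred1 m) s <=
      count (fun k => (0 < x k)%R) s)%N; last by apply: leq_trans; rewrite -addn1 leq_add2l.
  elim: (s) => //= a r ihr; rewrite addnACA leq_add //.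
  rewrite /x' lt_max ltxx orbF subr_gt0; have [->|_] := eqVneq a m.
    by rewrite ltxx xm.
  by rewrite addn0; case: ltP => // /(lt_trans xm) ->.
- by move=> k _; rewrite /x' le_max lexx orbT.
- move=> t t0; rewrite (eq_bigl (fun k => t + x m <= x k)); last first.
    by move=> k; rewrite /x' le_max lerBrDr [t <= 0]leNgt t0 orbF.
  by apply: h; rewrite addr_gt0.
Qed.

(** * The Brunn-Minkowski inequality on the integers *)

Lemma card_fset_geD (T : choiceType) (A Z : {fset T}) (s : seq T) :
  A `<=` Z -> uniq s -> (forall z, z \in s -> z \in Z /\ z \notin A) ->
  (#|` A| + size s <= #|` Z|)%N.
Proof.
move=> AZ us h; rewrite -size_cat; apply: uniq_leq_size.
  rewrite cat_uniq fset_uniq us andbT /=; apply/hasPn => z /h[_].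
  by [].
by move=> z; rewrite mem_cat => /orP[/(fsubsetP AZ)|/h[]].
Qed.

Section NearestIntegers.
Variables (R : realType) (Z : {fset int}) (x : R).
Hypothesis nearZ : forall z : int, `|z%:~R - x| < 1 -> z \in Z.

Lemma floor_near : Num.floor x \in Z.
Proof.
apply: nearZ; have /andP[h1 h2] := floor_itv x.
by rewrite ltr_norml; move: h2; rewrite intrD; lra.
Qed.

Lemma floorD1_near : (Num.floor x)%:~R < x -> Num.floor x + 1 \in Z.
Proof.
move=> h; apply: nearZ; have /andP[h1 h2] := floor_itv x.
by rewrite ltr_norml; move: h2; rewrite intrD; lra.
Qed.

End NearestIntegers.

(** The count of covered integers is compared with the length of the union of the
intervals [x, x + 1].  The fractional part of the leftmost x is the potential
which makes this exact: moving the leftmost point from x' down to x, with a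
step of at least delta <= 1, raises the count minus that fractional part by at
least delta. *)
Lemma card_near_step (R : realType) (x x' delta q : R) (A Z : {fset int}) :
  A `<=` Z -> (forall z : int, `|z%:~R - x| < 1 -> z \in Z) ->
  (forall z, z \in A -> Num.floor x' <= z) ->
  delta <= 1 -> x + delta <= x' -> 0 <= delta ->
  q + (x' - (Num.floor x')%:~R) <= #|` A|%:R ->
  q + delta + (x - (Num.floor x)%:~R) <= #|` Z|%:R.
Proof.
move=> AZ nearZ geA d1 xx' d0 hq.
have /andP[f1 f2] := floor_itv x; have /andP[f1' f2'] := floor_itv x'.
rewrite !intrD in f2 f2'.
have fZ := floor_near nearZ; have := floorD1_near nearZ.
set f := Num.floor x in fZ f1 f2 *; set f' := Num.floor x' in geA hq f1' f2'.
have notA z : z < f' -> z \notin A.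
  by move=> zf'; apply/negP => /geA; rewrite leNgt zf'.
move=> f1Z.
have ff' : f <= f' by apply: le_floor; lra.
have [eff'|/eqP nff'] := f =P f'.
  have : (#|` A|%:R : R) <= #|` Z|%:R by rewrite ler_nat fsubset_leq_card.
  by rewrite -eff' in hq; lra.
have lff' : f < f' by rewrite lt_neqAle nff'.
have A1 : (#|` A|%:R + 1 : R) <= #|` Z|%:R.
  rewrite natr1 ler_nat -addn1; apply: (@card_fset_geD _ A Z [:: f]) => //.
  by move=> z; rewrite inE => /eqP ->; split=> //; exact: notA.
have [eff'|nff''] := eqVneq f' (f + 1).
  by rewrite eff' intrD in hq; lra.
have lff'' : f + 1 < f' by rewrite lt_neqAle eq_sym nff'' lezD1.
have [fx|] := ltP f%:~R x; last by lra.
suff : (#|` A|%:R + 2 : R) <= #|` Z|%:R by lra.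
rewrite -natrD ler_nat; apply: (@card_fset_geD _ A Z [:: f; f + 1]) => //.
  by rewrite /= inE andbT lt_eqF ?ltzD1.
move=> z; rewrite !inE => /orP[]/eqP ->; split; [by []|exact: notA|exact: f1Z|exact: notA].
Qed.

Lemma card_near_base (R : realType) (x : R) (Z : {fset int}) :
  (forall z : int, `|z%:~R - x| < 1 -> z \in Z) ->
  1 + (x - (Num.floor x)%:~R) <= #|` Z|%:R.
Proof.
move=> nearZ; have /andP[f1 f2] := floor_itv x; rewrite intrD in f2.
have fZ := floor_near nearZ; have := floorD1_near nearZ.
have [fx /(_ isT) f1Z|xf _] := ltP (Num.floor x)%:~R x; last first.
  suff : (1 : R) <= #|` Z|%:R by lra.
  by rewrite ler1n cardfs_gt0; apply/fset0Pn; exists (Num.floor x).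
suff : (2 : R) <= #|` Z|%:R by lra.
rewrite ler_nat; apply: (@card_fset_geD _ fset0 Z [:: Num.floor x; Num.floor x + 1]) => //.
  by rewrite /= inE andbT lt_eqF ?ltzD1.
by move=> z; rewrite !inE => /orP[]/eqP ->.
Qed.

(** One coordinate of the condition that z lies in the sum of the weighted mean of
a and b and the open cube (-1, 1)^d. *)
Definition near_mean (R : realType) (lam : R) (a b z : int) : bool :=
  `|z%:~R - ((1 - lam) * a%:~R + lam * b%:~R)| < 1.

Lemma near_mean_floor_le (R : realType) (lam : R) (i j a b z : int) :
  0 <= lam <= 1 -> i <= a -> j <= b -> near_mean lam a b z ->
  Num.floor ((1 - lam) * i%:~R + lam * j%:~R) <= z.
Proof.
move=> /andP[l0 l1] ia jb; rewrite /near_mean ltr_norml => /andP[h _].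
rewrite -ltzD1 floor_lt_int intrD.
have : (i%:~R : R) <= a%:~R by rewrite ler_int.
have : (j%:~R : R) <= b%:~R by rewrite ler_int.
by move: h; nra.
Qed.

Lemma path_lt_min (i : int) s a : path <%R i s -> a \in i :: s -> i <= a.
Proof.
move=> /(order_path_min lt_trans)/allP ps /predU1P[->//|/ps]; exact: ltW.
Qed.

(** The means of all elements of the first sequence with the least element of the
second, followed by those of the greatest element of the first with all elements
of the second, form an increasing chain.  Its steps have length at least
1 - lam in the first part and at least lam in the second, and each of them is an
application of card_near_step. *)
Lemma brunn_minkowski_int_seq (R : realType) (lam : R) (i j : int) (s t : seq int)
    (Z : {fset int}) : 0 <= lam <= 1 ->
  path <%R i s -> path <%R j t ->
  (forall a b z, a \in i :: s -> b \in j :: t -> near_mean lam a b z -> z \in Z) ->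
  let x := (1 - lam) * i%:~R + lam * j%:~R in
  (1 - lam) * (size s).+1%:R + lam * (size t).+1%:R + (x - (Num.floor x)%:~R)
    <= #|` Z|%:R.
Proof.
move=> l01; have /andP[l0 l1] := l01; elim: s i Z => [|i' s ihs] i Z.
  elim: t j Z => [|j' t iht] j Z _.
    move=> _ h /=.
    have := @card_near_base _ ((1 - lam) * i%:~R + lam * j%:~R) Z.
    move=> /(_ (fun z hz => h i j z (mem_head _ _) (mem_head _ _) hz)).
    by rewrite !mulr1; lra.
  move=> /= /andP[jj' pt] h.
  pose x' := (1 - lam) * i%:~R + lam * j'%:~R.
  pose A := [fset z in Z | Num.floor x' <= z].
  have ij : (j%:~R : R) + 1 <= j'%:~R by rewrite -intrD1 ler_int lezD1.
  have := @card_near_step R ((1 - lam) * i%:~R + lam * j%:~R) x' lam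
    ((1 - lam) + lam * (size t).+1%:R) A Z.
  move=> step; rewrite -[(size t).+2%:R]natr1 mulr1 mulrDr mulr1 (addrA (1 - lam)).
  apply: step => //.
  - by apply/fsubsetP => z; rewrite !inE => /andP[].
  - by move=> z hz; apply: (h i j); rewrite ?mem_head.
  - by move=> z; rewrite !inE => /andP[].
  - by rewrite /x'; nra.
  - have := iht j' A isT pt; rewrite mulr1; apply=> a b z ai bj hz.
    rewrite !inE (h a b) //=; last by rewrite inE bj orbT.
    apply: near_mean_floor_le hz => //; last exact: path_lt_min bj.
    by move: ai; rewrite inE => /eqP ->.
move=> /= /andP[ii' ps] pt h.
pose x' := (1 - lam) * i'%:~R + lam * j%:~R.
pose A := [fset z in Z | Num.floor x' <= z].
have ij : (i%:~R : R) + 1 <= i'%:~R by rewrite -intrD1 ler_int lezD1.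
have := @card_near_step _ ((1 - lam) * i%:~R + lam * j%:~R) x' (1 - lam)
  ((1 - lam) * (size s).+1%:R + lam * (size t).+1%:R) A Z.
move=> step; rewrite -[(size s).+2%:R]natr1 mulrDr mulr1 (addrAC _ (1 - lam)).
apply: step => //.
- by apply/fsubsetP => z; rewrite !inE => /andP[].
- by move=> z hz; apply: (h i j); rewrite ?mem_head.
- by move=> z; rewrite !inE => /andP[].
- by lra.
- by rewrite /x'; nra.
- by lra.
- apply: ihs => // a b z ai bj hz.
  rewrite !inE (h a b) //=; last by rewrite inE ai orbT.
  by apply: near_mean_floor_le hz => //; [exact: path_lt_min ai|exact: path_lt_min bj].
Qed.

Lemma brunn_minkowski_int (R : realType) (lam : R) (I J Z : {fset int}) :
  0 <= lam <= 1 -> I != fset0 -> J != fset0 ->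
  (forall a b z, a \in I -> b \in J -> near_mean lam a b z -> z \in Z) ->
  (1 - lam) * #|` I|%:R + lam * #|` J|%:R <= #|` Z|%:R.
Proof.
have sortE (X : {fset int}) : X != fset0 -> exists i s,
    [/\ path <%R i s, #|` X| = (size s).+1 & forall a, a \in i :: s -> a \in X].
  rewrite -cardfs_gt0 => X0.
  have := size_sort <=%R X; have := sort_le_sorted X.
  have := mem_sort <=%R X; case e : (sort <=%R X) => [|i s] m so sz.
    by rewrite -sz in X0.
  exists i, s; split=> [||a]; [|by rewrite -sz|by rewrite m].
  have : sorted <%R (sort <=%R X) by rewrite sort_lt_sorted fset_uniq.
  by rewrite e.
move=> l01 /sortE[i [s [pi -> iI]]] /sortE[j [t [pj -> jJ]]] h.
have hZ a b z (ai : a \in i :: s) (bj : b \in j :: t) := h a b z (iI _ ai) (jJ _ bj).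
apply: le_trans (brunn_minkowski_int_seq l01 pi pj hZ).
by rewrite lerDl subr_ge0 floor_le.
Qed.

Lemma sumr_const_fset_cond (R : pzRingType) (T : choiceType) (X : {fset T}) (P : pred T) (w : R) :
  \sum_(i <- X | P i) w = #|` [fset i in X | P i]|%:R * w.
Proof.
by rewrite big_fset_condE big_const_seq count_predT iter_addr_0 mulr_natl.
Qed.

(** Divide a, b and c by v1^d, v2^d and the d-th power of the mean of v1 and v2.
Then the level sets of a and b at a height t <= 1 are nonempty, since the maxima
are attained, and their means lie near the level set of c, by the hypothesis
with s = t.  The inequality on the integers applies to each level, and summing
over the levels followed by holder_mean gives the conclusion.  The maxima are
given as powers, and the hypothesis with a factor s, to avoid roots and to cover
d = 0. *)
Lemma functional_brunn_minkowski_int (R : realType) d (lam : R)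
    (I J Z : {fset int}) (a b c : int -> R) (v1 v2 : R) :
  0 <= lam <= 1 -> 0 < v1 -> 0 < v2 ->
  (forall i, i \in I -> 0 <= a i <= v1 ^+ d) ->
  (forall j, j \in J -> 0 <= b j <= v2 ^+ d) ->
  (exists2 i, i \in I & a i = v1 ^+ d) ->
  (exists2 j, j \in J & b j = v2 ^+ d) ->
  (forall z, 0 <= c z) ->
  (forall i j z, i \in I -> j \in J -> near_mean lam i j z -> z \in Z /\
    forall s, 0 <= s -> s * v1 ^+ d <= a i -> s * v2 ^+ d <= b j ->
      s * ((1 - lam) * v1 + lam * v2) ^+ d <= c z) ->
  forall s u v, 0 <= s -> 0 <= u -> 0 <= v ->
  s * u ^+ d.+1 <= \sum_(i <- I) a i -> s * v ^+ d.+1 <= \sum_(j <- J) b j ->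
  s * ((1 - lam) * u + lam * v) ^+ d.+1 <= \sum_(z <- Z) c z.
Proof.
move=> l01 v1p v2p a0 b0 [i0 i0I ai0] [j0 j0J bj0] c0 h s u v s0 u0 v0 hu hv.
pose g := ((1 - lam) * v1 + lam * v2) ^+ d.
have /andP[l0 l1] := l01.
have v1d : 0 < v1 ^+ d by rewrite exprn_gt0.
have v2d : 0 < v2 ^+ d by rewrite exprn_gt0.
have g0 : 0 < g.
  rewrite exprn_gt0 //; have [->|ln] := eqVneq lam 0.
    by rewrite subr0 mul1r mul0r addr0.
  have lp : 0 < lam by rewrite lt0r ln.
  by apply: ltr_wpDl; [rewrite mulr_ge0 ?subr_ge0 // ltW|exact: mulr_gt0].
have key : (1 - lam) * (\sum_(i <- I) a i / v1 ^+ d) + lam * (\sum_(j <- J) b j / v2 ^+ d)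
    <= \sum_(z <- Z) c z / g.
  pose r : seq (R * R) := [seq (1, c z / g) | z <- Z] ++
    ([seq (- (1 - lam), a i / v1 ^+ d) | i <- I] ++
     [seq (- lam, b j / v2 ^+ d) | j <- J]).
  have /(layer_cake_ge0 (w := fst)) : forall p, p \in r -> 0 <= p.2.
    move=> p; rewrite !mem_cat => /or3P[] /mapP[k kX ->] /=.
    - by rewrite divr_ge0 // ltW.
    - by have /andP[? _] := a0 _ kX; rewrite divr_ge0 // ltW.
    - by have /andP[? _] := b0 _ kX; rewrite divr_ge0 // ltW.
  rewrite /r !big_cat !big_map /= -!mulr_sumr mul1r !mulNr -opprD subr_ge0.
  apply=> t t0.
  rewrite !big_cat !big_map /= !sumr_const_fset_cond.
  rewrite !mulrN -!opprD subr_ge0 mulr1 addrC.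
  set It := [fset i in I | _]; set Jt := [fset j in J | _]; set Zt := [fset z in Z | _].
  have [t1|t1] := lerP t 1; last first.
    have -> : It = fset0.
      apply/fsetP => i; rewrite !inE; apply/negP => /andP[/a0/andP[_ ai]].
      by rewrite ler_pdivlMr // leNgt (le_lt_trans ai) // ltr_pMl.
    have -> : Jt = fset0.
      apply/fsetP => j; rewrite !inE; apply/negP => /andP[/b0/andP[_ bj]].
      by rewrite ler_pdivlMr // leNgt (le_lt_trans bj) // ltr_pMl.
    by rewrite !cardfs0 !mul0r addr0.
  rewrite addrC mulrC (mulrC _ lam); apply: brunn_minkowski_int => //.
  - by apply/fset0Pn; exists i0; rewrite !inE i0I ai0 divff // lt0r_neq0.
  - by apply/fset0Pn; exists j0; rewrite !inE j0J bj0 divff // lt0r_neq0.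
  - move=> i j z; rewrite !inE => /andP[iI ti] /andP[jJ tj] /(h _ _ _ iI jJ)[-> /=].
    by rewrite ler_pdivlMr //; apply; rewrite -?ler_pdivlMr // ltW.
have [->|sn0] := eqVneq s 0; first by rewrite mul0r sumr_ge0.
have sp : 0 < s by rewrite lt0r sn0.
rewrite -!mulr_suml ler_pdivlMr // in key.
apply: le_trans key; rewrite -ler_pdivlMl // (mulrA s^-1) mulrDr.
rewrite (mulrCA s^-1 (1 - lam)) (mulrCA s^-1 lam).
by apply: holder_mean => //; rewrite mulrA divfK ?lt0r_neq0 // ler_pdivlMl.
Qed.

(** * The Brunn-Minkowski inequality for lattice points *)

Definition slice_head (X : {fset seq int}) (i : int) : {fset seq int} :=
  [fset behead x | x in [fset x in X | head 0 x == i]].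

Definition heads (X : {fset seq int}) : {fset int} := [fset head 0 x | x in X].

Lemma sum_card_filter_heads (X : {fset seq int}) :
  (\sum_(i <- heads X) #|` [fset x in X | head 0%R x == i]| = #|` X|)%N.
Proof.
rewrite card_fset_sum1 (partition_big_imfset _ (head 0)) /=.
by apply: eq_bigr => i _; rewrite card_fset_sum1 -big_fset_condE.
Qed.

Lemma sum_card_slice_head_le (X : {fset seq int}) :
  (\sum_(i <- heads X) #|` slice_head X i| <= #|` X|)%N.
Proof.
by rewrite -sum_card_filter_heads; apply: leq_sum => i _; exact: leq_imfset_card.
Qed.

Lemma sum_card_slice_head d (X : {fset seq int}) :
  (forall x, x \in X -> size x = d.+1) ->
  (\sum_(i <- heads X) #|` slice_head X i| = #|` X|)%N.
Proof.
move=> sX; rewrite -sum_card_filter_heads; apply: eq_bigr => i _.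
apply: card_in_imfset => -[|a x] [|b y]; rewrite !inE /=;
  by move=> /andP[/sX // _] /eqP -> /andP[/sX // _] /eqP -> ->.
Qed.

Lemma slice_headP X i x : i :: x \in X -> x \in slice_head X i.
Proof.
by move=> ixX; apply/imfsetP; exists (i :: x); rewrite //= !inE ixX eqxx.
Qed.

Lemma slice_head_cons d (X : {fset seq int}) i x :
  (forall x, x \in X -> size x = d.+1) ->
  x \in slice_head X i -> i :: x \in X.
Proof.
by move=> sX /imfsetP[[|a y]] /=; rewrite !inE /= => /andP[/[dup] /sX // _ yX] /eqP <- ->.
Qed.

Lemma heads_slice (X : {fset seq int}) i : (i \in heads X) = (slice_head X i != fset0).
Proof.
apply/imfsetP/fset0Pn => [[x /= xX ->]|[y /imfsetP[x /=]]].
  by exists (behead x); apply/imfsetP; exists x; rewrite //= !inE xX eqxx.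
by rewrite !inE => /andP[xX /eqP <-] _; exists x.
Qed.

Lemma exists_max (T : choiceType) (X : {fset T}) (f : T -> nat) : X != fset0 ->
  exists2 m, m \in X & forall x, x \in X -> (f x <= f m)%N.
Proof.
move=> /fset0Pn[x0 x0X].
have : has predT X by apply/hasP; exists x0.
move=> /(has_argmin (fun x => - (f x)%:R : int))[m [mX _ mmin]].
exists m => // x /mmin /(_ isT); rewrite lerN2 ler_nat; exact.
Qed.

(** For d = 0 the only power is 1; this is the count of points in dimension 0. *)
Lemma exists_root (R : realType) d (k : nat) : (0 < k)%N -> (d = 0 -> k = 1)%N ->
  exists2 v : R, 0 < v & k%:R = v ^+ d.
Proof.
case: d => [|d] k0 kd; first by exists 1; rewrite // kd.
exists (k%:R `^ d.+1%:R^-1); first by apply: powR_gt0; rewrite ltr0n.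
by rewrite -powR_mulrn ?powR_ge0 // -powRrM mulVf ?pnatr_eq0 // powRr1.
Qed.

Fixpoint near_means (R : realType) (lam : R) (a b z : seq int) : bool :=
  match a, b, z with
  | i :: a', j :: b', k :: z' => near_mean lam i j k && near_means lam a' b' z'
  | [::], [::], [::] => true
  | _, _, _ => false
  end.

Lemma near_means_nth (R : realType) (lam : R) (a b z : seq int) : near_means lam a b z ->
  [/\ size a = size z, size b = size z &
      forall i, (i < size z)%N -> near_mean lam (nth 0 a i) (nth 0 b i) (nth 0 z i)].
Proof.
elim: a b z => [|i a ih] [|j b] [|k z] //= /andP[hn /ih[sa sb h]].
by split; [rewrite sa|rewrite sb|case=> [|l /h]].
Qed.

(** The Brunn-Minkowski inequality for lattice points.  The factor s replaces the
extraction of d-th roots of the cardinalities.  Slicing by the first coordinate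
reduces the inequality in dimension d + 1 to the functional inequality for the
cardinalities of the slices, which are compared by induction. *)
Lemma brunn_minkowski_lattice (R : realType) (lam : R) d (A B C : {fset seq int}) :
  0 <= lam <= 1 -> A != fset0 -> B != fset0 ->
  (forall a, a \in A -> size a = d) -> (forall b, b \in B -> size b = d) ->
  (forall a b z, a \in A -> b \in B -> near_means lam a b z -> z \in C) ->
  forall s u v, 0 <= s -> 0 <= u -> 0 <= v ->
  s * u ^+ d <= #|` A|%:R -> s * v ^+ d <= #|` B|%:R ->
  s * ((1 - lam) * u + lam * v) ^+ d <= #|` C|%:R.
Proof.
move=> l01; elim: d A B C => [|d ih] A B C A0 B0 sA sB h s u v s0 u0 v0.
  rewrite !expr0 mulr1 => sA1 _; apply: le_trans sA1 _.
  rewrite ler_nat; apply: leq_trans (_ : #|` [fset [::] : seq int]| <= _)%N.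
    apply: fsubset_leq_card; apply/fsubsetP => a /sA/size0nil ->.
    by rewrite inE.
  rewrite cardfs1 cardfs_gt0; apply/fset0Pn; exists [::].
  move/fset0Pn : A0 => [a aA]; move/fset0Pn : B0 => [b bB].
  by apply: (h a b) => //; rewrite (size0nil (sA _ aA)) (size0nil (sB _ bB)).
have slice_size (X : {fset seq int}) i : (forall x, x \in X -> size x = d.+1) ->
    forall x, x \in slice_head X i -> size x = d.
  by move=> sX x /(slice_head_cons sX)/sX /= [].
have root (X : {fset seq int}) : X != fset0 -> (forall x, x \in X -> size x = d.+1) ->
    exists v : R, [/\ 0 < v,
      forall i, i \in heads X -> 0 <= (#|` slice_head X i|%:R : R) <= v ^+ d &
      exists2 i, i \in heads X & #|` slice_head X i|%:R = v ^+ d].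
  move=> X0 sX.
  have : heads X != fset0.
    move/fset0Pn : X0 => [x xX]; apply/fset0Pn; exists (head 0 x).
    by apply/imfsetP; exists x.
  move=> /(exists_max (fun i => #|` slice_head X i|))[m mX mmax].
  have := mX; rewrite heads_slice -cardfs_gt0 => m0.
  have [|w w0 ew] := @exists_root R d _ m0.
    move=> d0; apply/eqP; rewrite eqn_leq m0 andbT -(cardfs1 ([::] : seq int)).
    apply: fsubset_leq_card; apply/fsubsetP => x /(slice_size _ _ sX).
    by rewrite d0 inE => /size0nil ->.
  exists w; split=> //; last by exists m.
  by move=> i iX; rewrite ler0n -ew ler_nat mmax.
have [v1 [v1p a1 e1]] := root _ A0 sA.
have [v2 [v2p a2 e2]] := root _ B0 sB.
rewrite -(sum_card_slice_head sA) -(sum_card_slice_head sB) !natr_sum => hA hB.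
apply: le_trans (_ : (\sum_(i <- heads C) #|` slice_head C i|)%:R <= _); last first.
  by rewrite ler_nat sum_card_slice_head_le.
rewrite natr_sum.
apply: (functional_brunn_minkowski_int l01 v1p v2p a1 a2 e1 e2 _ _ s0 u0 v0 hA hB) => //.
move=> i j z iA jB hz.
have cz : forall a b y, a \in slice_head A i -> b \in slice_head B j ->
    near_means lam a b y -> y \in slice_head C z.
  move=> a b y /(slice_head_cons sA) aA /(slice_head_cons sB) bB hy.
  by apply: slice_headP; apply: (h _ _ _ aA bB); rewrite /= hz.
rewrite !heads_slice in iA jB *.
have cz' := ih _ _ _ iA jB (slice_size _ _ sA) (slice_size _ _ sB) cz.
split; last by move=> t t0; apply: cz' => //; exact: ltW.
(* the case s = u = v = 1 shows that the slice of C is inhabited *)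
rewrite -cardfs_gt0 -(ler1n R).
have := cz' 1 1 1 ler01 ler01 ler01.
by rewrite !mulr1 subrK expr1n mul1r !ler1n !cardfs_gt0; apply.
Qed.

(** * Moments of cones *)

(** The sum over the integer heights k of k^p times the volume of the section at
height k of a cone of height m, whose base has dimension n and unit volume. *)
Definition cone_moment (R : realType) (n p : nat) (m : R) : R :=
  \sum_(0 <= k < (Num.truncn m).+1) (1 - k%:R / m) ^+ n * k%:R ^+ p.

Lemma B_cone_moment (R : realType) (n p : nat) (m : R) : 0 < m ->
  B n.+1 m p.+1%:R = p.+1%:R / m ^+ p.+1 * cone_moment n p m.
Proof.
move=> m0; rewrite /B /cone_moment mulr_sumr; apply: eq_bigr => k _.
rewrite -[p.+1%:R - 1]/(p.+1%:R - 1%:R) -natrB // subn1 /= powR_mulrn; last first.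
  by rewrite divr_ge0 // ltW.
rewrite expr_div_n exprSr; field.
by rewrite expf_neq0 ?lt0r_neq0.
Qed.

Lemma cone_moment_ge0 (R : realType) (n p : nat) (m : R) : 0 < m ->
  0 <= cone_moment n p m.
Proof.
move=> m0; rewrite /cone_moment big_nat; apply: sumr_ge0 => k /andP[_ km].
rewrite mulr_ge0 ?exprn_ge0 // subr_ge0 ler_pdivrMr // mul1r.
by rewrite -truncn_ge_nat // ltW.
Qed.

(** Clipping at 0 frees the range of summation from m, so that continuity in m
becomes visible.  For n = 0 the clipped terms are 0^0 = 1 and the two moments
differ. *)
Definition clipped_cone_moment (R : realType) (n p K : nat) (m : R) : R :=
  \sum_(0 <= k < K) (Num.max (1 - k%:R / m) 0) ^+ n * k%:R ^+ p.

Lemma cone_clip_lt (R : realType) (m : R) k : 0 < m -> m < k%:R ->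
  Num.max (1 - k%:R / m) 0 = 0.
Proof.
by move=> m0 mk; rewrite max_r // subr_le0 ler_pdivlMr // mul1r ltW.
Qed.

Lemma cone_clip_ge (R : realType) (m : R) k : 0 < m -> k%:R <= m ->
  Num.max (1 - k%:R / m) 0 = 1 - k%:R / m.
Proof.
by move=> m0 mk; rewrite max_l // subr_ge0 ler_pdivrMr // mul1r.
Qed.

Lemma cone_momentE (R : realType) (n p K : nat) (m : R) : (0 < n)%N -> 0 < m ->
  m < K%:R -> cone_moment n p m = clipped_cone_moment n p K m.
Proof.
move=> n0 m0 mK; rewrite /clipped_cone_moment.
rewrite (@big_cat_nat _ _ _ (Num.truncn m).+1) //=; last first.
  by rewrite truncn_lt_nat // ltW.
rewrite [X in _ = _ + X]big_nat [X in _ = _ + X]big1 ?addr0; last first.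
  move=> k /andP[km _]; rewrite cone_clip_lt // ?expr0n ?gtn_eqF ?mul0r //.
  by rewrite -truncn_lt_nat // ltW.
apply: eq_big_nat => k /andP[_ km].
by rewrite cone_clip_ge // -truncn_ge_nat // ltW.
Qed.

Lemma clipped_cone_moment_continuous (R : realType) (n p K : nat) (m : R) :
  0 < m -> {for m, continuous (clipped_cone_moment n p K)}.
Proof.
move=> m0; elim: K => [|K ih].
  rewrite /clipped_cone_moment.
  rewrite (_ : (fun _ => _) = cst 0); first exact: cst_continuous.
  by apply/funext => x; rewrite big_geq.
rewrite (_ : clipped_cone_moment _ _ _ = fun x : R => clipped_cone_moment n p K x +
  (Num.max (1 - K%:R / x) 0) ^+ n * K%:R ^+ p); last first.
  by apply/funext => x; rewrite /clipped_cone_moment big_nat_recr.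
apply: cvgD; first exact: ih.
apply: cvgMl.
apply: (@continuous_comp _ _ _ (fun x : R => Num.max (1 - K%:R / x) 0) (fun y => y ^+ n));
  last exact: exprn_continuous.
apply: continuous_max; last exact: cst_continuous.
apply: cvgB; first exact: cvg_cst.
apply: cvgMr; apply: cvgV; [exact: lt0r_neq0|exact: cvg_id].
Qed.

(** The middle term k = Q + 2 alone contributes (Q + 2) ((Q + 2) / 2)^n. *)
Lemma cone_moment_large (R : realType) (n Q : nat) :
  (Q%:R : R) <= cone_moment n n.+1 (2 * Q.+2)%:R.
Proof.
rewrite /cone_moment natrK; set m := (2 * Q.+2)%N.
have m0 : 0 < (m%:R : R) by rewrite ltr0n.
have term_ge0 k : (k < m.+1)%N -> 0 <= (1 - k%:R / m%:R) ^+ n * k%:R ^+ n.+1 :> R.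
  move=> km; rewrite mulr_ge0 ?exprn_ge0 // subr_ge0 ler_pdivrMr // mul1r ler_nat.
  by rewrite -ltnS.
have Qm : (Q.+2 < m.+1)%N by rewrite /m; lia.
rewrite (@big_cat_nat _ _ _ Q.+2) //=; last exact: ltnW.
rewrite (@big_ltn _ _ _ Q.+2) //= addrCA.
apply: (@le_trans _ _ Q.+2%:R); first by rewrite ler_nat; lia.
apply: ler_wpDr.
  rewrite addr_ge0 // big_nat; apply: sumr_ge0 => k /andP[_ km]; apply: term_ge0 => //.
  exact: ltn_trans km _.
have -> : 1 - Q.+2%:R / m%:R = 2^-1 :> R.
  by rewrite /m natrM; field; rewrite -natr1 gt_eqF // ltr_wpDl.
rewrite exprS mulrCA -exprMn ler_peMr // exprn_ege1 // mulrC ler_pdivlMr // mul1r.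
by rewrite ler_nat.
Qed.

(** The crossing argument of Berwald.  The last hypothesis is the
Brunn-Minkowski inequality between the levels 0 and k.  In dimension n = 0 the
moments jump at the integers, but g is constant and the height M + 1/2 gives
equality on the side of g. *)
Lemma exists_threshold (R : realType) (n M : nat) (g gC : nat -> R) :
  (0 < M)%N -> 0 < g 0%N -> 0 < g M ->
  (forall k, (k <= M)%N -> 0 <= g k <= gC k) ->
  (n = 0%N -> forall k, (k <= M)%N -> g k = g 0%N) ->
  (forall i k v, (0 < k <= M)%N -> (i <= k)%N -> 0 <= v -> g 0%N * v ^+ n <= g k ->
    g 0%N * ((1 - i%:R / k%:R) + i%:R / k%:R * v) ^+ n <= gC i) ->
  exists m, [/\ M%:R <= m, 1 < m,
    \sum_(0 <= k < M.+1) k%:R ^+ n.+1 * g k <= g 0%N * cone_moment n n.+1 m &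
    g 0%N * cone_moment n 0 m <= \sum_(0 <= k < M.+1) gC k].
Proof.
move=> M0 g0 gM gC0 gn BM.
set A := \sum_(_ <= _ < _) _ * _; set Gam := \sum_(_ <= _ < _) gC _.
case: (posnP n) => [n0|np].
  exists (M%:R + 2^-1).
  have tr : Num.truncn (M%:R + 2^-1 : R) = M.
    by apply: truncn_def; rewrite -[M.+1%:R]natr1; apply/andP; split; lra.
  have M1 : (1 : R) <= M%:R by rewrite ler1n.
  split; [lra|lra| |].
  - rewrite /A /cone_moment tr mulr_sumr !big_nat; apply: ler_sum => k /andP[_ kM].
    by rewrite (gn n0) // n0 expr0 mul1r mulrC.
  - rewrite /Gam /cone_moment tr mulr_sumr !big_nat; apply: ler_sum => k /andP[_ kM].
    by rewrite n0 !expr0 !mulr1 -(gn n0 k) //; have /andP[] := gC0 k kM.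
have M0R : 0 < (M%:R : R) by rewrite ltr0n.
have A0 : 0 < A.
  rewrite /A big_nat_recr //= ltr_wpDl //.
    rewrite big_nat; apply: sumr_ge0 => k /andP[_ kM].
    by have /andP[gk _] := gC0 k (ltnW kM); rewrite mulr_ge0 // exprn_ge0.
  by rewrite mulr_gt0 // exprn_gt0.
have [TA|TA] := lerP A (g 0%N * cone_moment n n.+1 M%:R).
  exists M%:R; split => //.
  - rewrite ltr1n ltn_neqAle M0 andbT; apply/eqP => M1.
    move: TA; rewrite leNgt -M1 /cone_moment natrK !big_nat_recr //= big_geq //.
    by rewrite !divr1 subrr !expr0n (gtn_eqF np) !(mulr0, mul0r, addr0) A0.
  - rewrite /Gam /cone_moment natrK mulr_sumr !big_nat; apply: ler_sum => k /andP[_ kM].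
    rewrite expr0 mulr1; have := BM k M 0; rewrite M0 leqnn mulr0 addr0; apply => //.
    by rewrite expr0n gtn_eqF // mulr0 ltW.
pose Q := (M + (Num.truncn (A / g 0%N)).+1)%N.
pose b : R := (2 * Q.+2)%:R.
have Mb : M%:R <= b by rewrite ler_nat /Q; lia.
have TbA : A / g 0%N <= cone_moment n n.+1 b.
  apply: le_trans (cone_moment_large R n Q).
  have /andP[_ /ltW/le_trans] := truncn_itv (divr_ge0 (ltW A0) (ltW g0)).
  by apply; rewrite ler_nat leq_addl.
have [m mI Fm] : exists2 m, m \in `[M%:R, b] & cone_moment n n.+1 m = A / g 0%N.
  have clipE x : M%:R <= x <= b ->
      cone_moment n n.+1 x = clipped_cone_moment n n.+1 (2 * Q.+2).+1 x.
    move=> /andP[Mx xb]; apply: cone_momentE => //; first exact: lt_le_trans Mx.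
    by apply: le_lt_trans xb _; rewrite ltr_nat.
  have [||m mI <-] := @IVT R (clipped_cone_moment n n.+1 (2 * Q.+2).+1) _ _ (A / g 0%N) Mb.
  - apply: continuous_in_subspaceT => x; rewrite inE /= in_itv /= => /andP[Mx _].
    by apply: clipped_cone_moment_continuous; exact: lt_le_trans Mx.
  - rewrite -!clipE ?lexx ?Mb // ge_min le_max TbA orbT andbT.
    by rewrite ler_pdivlMr // mulrC (ltW TA).
  - by exists m => //; apply: clipE; rewrite in_itv in mI.
have Mm : M%:R <= m by move: mI; rewrite in_itv => /andP[].
have M1m : 1 < m.
  rewrite lt_neqAle (le_trans _ Mm) ?ler1n // andbT; apply/eqP => em.
  have M1 : M = 1%N by apply/eqP; rewrite eqn_leq M0 andbT -(ler_nat R) -em in Mm *.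
  by move: TA; rewrite M1 em Fm mulrC divfK ?ltxx // lt0r_neq0.
have m0 : 0 < m by apply: lt_trans M1m.
(* phi is the cone; k1 is the last level where g reaches it *)
pose phi k := Num.max (1 - k%:R / m) 0 ^+ n.
have phi0 k : 0 <= phi k by rewrite exprn_ge0 // le_max lexx orbT.
have [k1 [k1M gk1 k1max]] : exists k1, [/\ (k1 <= M)%N, g 0%N * phi k1 <= g k1 &
    forall k, (k1 < k <= M)%N -> g k < g 0%N * phi k].
  pose P k := (k <= M)%N && (g 0%N * phi k <= g k).
  have P0 : exists k, P k.
    by exists 0%N; rewrite /P /phi leq0n mul0r subr0 max_l // expr1n mulr1 lexx.
  have PM k : P k -> (k <= M)%N by case/andP.
  case: (ex_maxnP P0 PM) => k1 /andP[k1M gk1] mx; exists k1; split=> // k /andP[k1k kM].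
  by rewrite ltNge; apply: contraL k1k => gk; rewrite -leqNgt mx // /P kM.
pose K := (Num.truncn m).+1.
have MK : (M < K)%N by rewrite ltnS truncn_ge_nat // ltW.
have mK : m < K%:R by rewrite /K; have /andP[] := truncn_itv (ltW m0).
(* h extends g by 0 up to the level K beyond the tip of the cone *)
pose h k := if (k <= M)%N then g k else 0.
have sumh (f : nat -> R) : \sum_(0 <= k < K) f k * h k = \sum_(0 <= k < M.+1) f k * g k.
  rewrite (@big_cat_nat _ _ _ M.+1) //= [X in _ + X]big_nat [X in _ + X]big1 ?addr0.
    by apply: eq_big_nat => k /andP[_ kM]; rewrite /h -ltnS kM.
  by move=> k /andP[Mk _]; rewrite /h leqNgt Mk mulr0.
have moment0 : \sum_(0 <= k < K) k%:R ^+ n.+1 * (h k - g 0%N * phi k) = 0.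
  under eq_bigr do rewrite mulrBr mulrCA.
  rewrite sumrB sumh -mulr_sumr -/A (_ : \sum_(_ <= _ < _) _ = cone_moment n n.+1 m).
    by rewrite Fm mulrCA divff ?mulr1 ?subrr // lt0r_neq0.
  rewrite (cone_momentE n.+1 np m0 mK); apply: eq_bigr => k _; exact: mulrC.
have k1p : (0 < k1)%N.
  rewrite lt0n; apply/eqP => k10; move/eqP: moment0; apply/negP; rewrite lt_eqF //.
  have neg k : (0 < k <= M)%N -> k%:R ^+ n.+1 * (h k - g 0%N * phi k) < 0.
    move=> /[dup] /andP[kp kM]; rewrite -{1}k10 => kk.
    by rewrite pmulr_rlt0 ?exprn_gt0 ?ltr0n // subr_lt0 /h kM k1max.
  rewrite big_ltn ?(leq_ltn_trans _ MK) // expr0n mul0r add0r.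
  rewrite big_ltn ?(leq_ltn_trans M0 MK) //.
  apply: (@lt_le_trans _ _ (0 + 0)); last by rewrite addr0.
  apply: ltr_leD; first by rewrite neg.
  rewrite big_nat; apply: sumr_le0 => k /andP[kp _].
  have [kM|Mk] := leqP k M; first by rewrite ltW // neg // kM (ltn_trans _ kp).
  rewrite /h leqNgt Mk /= sub0r mulrN oppr_le0 mulr_ge0 ?exprn_ge0 //.
  by rewrite mulr_ge0 // ltW.
exists m; split => //; first by rewrite Fm mulrCA divff ?mulr1 // lt0r_neq0.
(* H is at least the cone up to k1 and at most the cone afterwards *)
pose H k := if (k <= k1)%N then gC k else h k.
have HG : \sum_(0 <= k < K) H k <= Gam.
  rewrite (@big_cat_nat _ _ _ M.+1) //= [X in _ + X]big_nat [X in _ + X]big1 ?addr0.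
    rewrite /Gam !big_nat; apply: ler_sum => k /andP[_ kM].
    by rewrite /H; case: ifP => // _; rewrite /h -ltnS kM; have /andP[] := gC0 k kM.
  move=> k /andP[Mk _]; rewrite /H leqNgt (leq_ltn_trans k1M Mk) /=.
  by rewrite /h leqNgt Mk.
apply: le_trans HG; rewrite (cone_momentE 0 np m0 mK) mulr_sumr -subr_ge0 -sumrB.
have k1N : 0 < (k1%:R : R) ^+ n.+1 by rewrite exprn_gt0 // ltr0n.
rewrite -(pmulr_rge0 _ k1N) -[leLHS]moment0 mulr_sumr.
apply: ler_sum => k _; rewrite expr0 mulr1 -/(phi k).
have [kk1|k1k] := leqP k k1.
  have k1m : k1%:R <= m by rewrite (le_trans _ Mm) // ler_nat.
  have k1m1 : k1%:R / m <= 1 by rewrite ler_pdivrMr ?mul1r.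
  have km : k%:R <= m by rewrite (le_trans _ k1m) // ler_nat.
  have gCk : g 0%N * phi k <= gC k.
    have := BM k k1 (1 - k1%:R / m); rewrite k1p k1M kk1 subr_ge0 k1m1.
    move: gk1; rewrite /phi !cone_clip_ge // => gk1 /(_ isT isT isT gk1).
    suff -> : 1 - k%:R / k1%:R + k%:R / k1%:R * (1 - k1%:R / m) = 1 - k%:R / m by [].
    by field; rewrite !lt0r_neq0 // ltr0n.
  rewrite /H kk1; apply: (@le_trans _ _ (k%:R ^+ n.+1 * (gC k - g 0%N * phi k))).
    rewrite ler_wpM2l ?exprn_ge0 // lerD2r /h (leq_trans kk1 k1M).
    by have /andP[] := gC0 k (leq_trans kk1 k1M).
  by rewrite ler_wpM2r ?subr_ge0 // lerXn2r ?nnegrE // ler_nat.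
rewrite /H leqNgt k1k /= ler_wnM2r ?lerXn2r ?nnegrE // ?ler_nat ?(ltnW k1k) //.
rewrite subr_le0 /h; case: leqP => kM; first by rewrite ltW // k1max // k1k.
by rewrite mulr_ge0 // ltW.
Qed.

(** Let A be the sum on the left and T0, T1 the cone moments of orders 0 and n + 1.
The normalizations of the two factors B cancel, and the left-hand side becomes
(2 T0)^(n+2) A / T1.  The m of exists_threshold satisfies A <= g(0) T1 and
2 g(0) T0 <= Gam.  For M = 0 the sum A vanishes and any m0 > 1 will do. *)
Lemma discrete_berwald (R : realType) (n M : nat) (g gC : nat -> R) (Gam : R) :
  (forall k, (k <= M)%N -> 0 < g k <= gC k) ->
  (n = 0%N -> forall k, (k <= M)%N -> g k = g 0%N) ->
  (forall i k v, (0 < k <= M)%N -> (i <= k)%N -> 0 <= v -> g 0%N * v ^+ n <= g k ->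
    g 0%N * ((1 - i%:R / k%:R) + i%:R / k%:R * v) ^+ n <= gC i) ->
  2 * \sum_(0 <= k < M.+1) gC k <= Gam ->
  exists m0, [/\ M%:R <= m0, 1 < m0 &
    n.+2%:R * (B n.+1 m0 n.+2%:R)^-1 / (B n.+1 m0 1) ^- n.+2 * 2 ^+ n.+1
      * (2 * \sum_(0 <= k < M.+1) k%:R ^+ n.+1 * g k)
    <= Gam ^+ n.+2 / g 0%N ^+ n.+1].
Proof.
move=> g_pos gn BM enum; have gp k : (k <= M)%N -> 0 < g k by move=> /g_pos/andP[].
have g0 : 0 < g 0%N by exact: gp.
have Gam0 : 0 <= Gam.
  apply: le_trans enum; rewrite mulr_ge0 // big_nat; apply: sumr_ge0 => k /andP[_ kM].
  by have /andP[gk gCk] := g_pos k kM; rewrite (le_trans _ gCk) // ltW.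
set A := \sum_(_ <= _ < _) _ * _.
case: (posnP M) => [M0|Mp].
  exists 2; rewrite M0; split; rewrite ?ler0n ?ltr1n //.
  rewrite /A M0 big_nat1 expr0n mul0r !mulr0 divr_ge0 ?exprn_ge0 //; exact: ltW.
have [m [Mm m1 hA hG]] : exists m, [/\ M%:R <= m, 1 < m,
    A <= g 0%N * cone_moment n n.+1 m &
    g 0%N * cone_moment n 0 m <= \sum_(0 <= k < M.+1) gC k].
  apply: exists_threshold => //; first exact: gp.
  by move=> k /g_pos/andP[/ltW -> ->].
exists m; split=> //.
have m0 : 0 < m by apply: lt_trans m1.
have := B_cone_moment n 0 m0; rewrite expr1 => ->.
rewrite (B_cone_moment n n.+1 m0).
have T0_ge0 := cone_moment_ge0 n 0 m0.
set T0 := cone_moment n 0 m in hG T0_ge0 *; set T1 := cone_moment n n.+1 m in hA *.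
have A0 : 0 < A.
  rewrite /A big_nat_recr //= ltr_wpDl // ?mulr_gt0 ?exprn_gt0 ?ltr0n //.
    rewrite big_nat; apply: sumr_ge0 => k /andP[_ kM].
    by rewrite mulr_ge0 ?exprn_ge0 // ltW // gp // ltnW.
  exact: gp.
have T1_gt0 : 0 < T1 by rewrite -(pmulr_rgt0 _ g0); exact: lt_le_trans hA.
have N0 : n.+2%:R != 0 :> R by rewrite pnatr_eq0.
have -> : n.+2%:R * (n.+2%:R / m ^+ n.+2 * T1)^-1 / (1 / m * T0) ^- n.+2 * 2 ^+ n.+1 * (2 * A) =
    (2 * T0) ^+ n.+2 * (A / T1).
  have m2 : m ^+ n.+2 != 0 by rewrite expf_neq0 ?lt0r_neq0.
  rewrite exprMn expr_div_n expr1n [(2 * T0) ^+ _]exprMn (exprSr 2 n.+1).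
  rewrite invrK; move: (m ^+ n.+2) (T0 ^+ n.+2) (2 ^+ n.+1) n.+2%:R m2 N0 => q t e N q0 N0.
  by field; rewrite (lt0r_neq0 T1_gt0) q0 N0.
apply: (@le_trans _ _ ((2 * T0) ^+ n.+2 * g 0%N)).
  by rewrite ler_wpM2l ?exprn_ge0 ?mulr_ge0 // ler_pdivrMr.
rewrite ler_pdivlMr ?exprn_gt0 // -mulrA -exprS -exprMn lerXn2r ?nnegrE //.
  by rewrite !mulr_ge0 // ltW.
by apply: le_trans enum; rewrite -mulrA ler_pM2l // mulrC.
Qed.

(** * The Steiner symmetral *)

Local Close Scope fset_scope.
Local Open Scope classical_set_scope.
Local Open Scope ring_scope.

Section Coordinates.
Variables (R : realType) (n : nat).
Implicit Types x y z : 'rV[R]_n.+1.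

Lemma e_lastE (j : 'I_1) (i : 'I_n.+1) : e_last R n j i = (i == ord_max)%:R.
Proof. by rewrite /e_last mxE ord1 eqxx. Qed.

Lemma inner_e_last x : inner x (e_last R n) = x 0 ord_max.
Proof.
rewrite /inner (bigD1 ord_max) //= e_lastE eqxx mulr1 big1 ?addr0 //.
by move=> i im; rewrite e_lastE (negPf im) mulr0.
Qed.

Lemma projE x i : proj x 0 i = if i == ord_max then 0 else x 0 i.
Proof.
rewrite /proj inner_e_last !mxE eqxx /=; case: eqP => [->|_].
  by rewrite mulr1 subrr.
by rewrite mulr0 subr0.
Qed.

Lemma eq_proj x y : proj x = proj y <-> forall i, i != ord_max -> x 0 i = y 0 i.
Proof.
split=> [/rowP xy i im|xy].
  by have := xy i; rewrite !projE (negPf im).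
by apply/rowP => i; rewrite !projE; case: eqP => // /eqP /xy.
Qed.

Lemma proj_add_last x : x = proj x + x 0 ord_max *: e_last R n.
Proof. by rewrite /proj inner_e_last subrK. Qed.

Lemma fiberE x z : fiber (proj x) z <-> proj z = proj x.
Proof.
split=> [[_ [t _ <-] <-]|zx].
  apply/eq_proj => i im.
  by rewrite mxE projE (negPf im) !mxE (negPf im) andbF mulr0 addr0.
by exists (z 0 ord_max *: e_last R n); [exists (z 0 ord_max)|rewrite -zx -proj_add_last].
Qed.

End Coordinates.

Lemma lebesgue_measure_segment (R : realType) (a b : R) : a <= b ->
  lebesgue_measure `[a, b] = (b - a)%:E.
Proof.
rewrite lebesgue_measure_itv /= lte_fin EFinB le_eqVlt => /predU1P[->|->//].
by rewrite ltxx -EFinB subrr.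
Qed.

Lemma lebesgue_measure_le (R : realType) (A C : set R) : measurable A -> measurable C -> A `<=` C ->
  (lebesgue_measure A <= lebesgue_measure C)%E.
Proof. by move=> mA mC AC; apply: le_measure; rewrite ?inE. Qed.
Section ConvexBody.
Variables (R : realType) (n : nat) (K : set 'rV[R]_n.+1).
Hypothesis (cK : compact K) (vK : convex_set K).
Implicit Types x y z p q : 'rV[R]_n.+1.

Lemma convex_combination p q (t : R) : 0 <= t <= 1 -> K p -> K q ->
  K ((1 - t) *: p + t *: q).
Proof.
move=> /andP[t0 t1] Kp Kq.
have := @vK q p (Itv01 t0 t1); rewrite !inE => /(_ Kq Kp).
by rewrite /conv /= addrC.
Qed.

Lemma fiber_compact x : compact (K `&` fiber (proj x)).
Proof.
apply: compact_closedI => //.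
rewrite (_ : fiber _ = \bigcap_(i in [set i : 'I_n.+1 | i != ord_max]) [set z | z 0 i = x 0 i]).
  apply: closed_bigI => i _.
  have : closed [set y | y = x 0 i] by exact: closed_eq.
  by move/closed_comp; apply => z _; exact: coord_continuous.
apply/seteqP; split=> z; rewrite fiberE eq_proj; exact.
Qed.

(** A fiber of a compact convex set is a segment, so its length is the largest
difference of heights of two of its points.  This description no longer
mentions the measure, and makes convexity of the symmetral evident. *)
Lemma steinerP x : steiner K x <-> exists p q,
  [/\ K p, K q, proj p = proj x, proj q = proj x &
      2 * `|x 0 ord_max| <= q 0 ord_max - p 0 ord_max].
Proof.
set D := K `&` fiber (proj x).
have cD : compact D by exact: fiber_compact.
pose f z : R := z 0 ord_max.
have cf : {within D, continuous f}.
  by apply: continuous_subspaceT => z; exact: coord_continuous.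
have fD : [set inner z (e_last R n) | z in D] = f @` D.
  by apply: eq_imagel => z _; rewrite inner_e_last.
rewrite /steiner /= /vol1 -/D fD inner_e_last.
split=> [[[k Kk kx] xvol]|[p [q [Kp Kq px qx xpq]]]].
  have D0 : D !=set0 by exists k; split=> //; apply/fiberE.
  have [q] := compact_EVT_max D0 cD cf; rewrite inE => -[Kq /fiberE qx] qmax.
  have [p] := compact_EVT_min D0 cD cf; rewrite inE => -[Kp /fiberE px] pmin.
  exists p, q; split=> //.
  have pq : f p <= f q by apply: pmin; rewrite inE; split=> //; apply/fiberE.
  have vol : (lebesgue_measure (f @` D) <= (f q - f p)%:E)%E.
    rewrite -lebesgue_measure_segment //; apply: lebesgue_measure_le => //.
      by apply: compact_measurable; exact: continuous_compact.
    by move=> _ [z Dz <-]; rewrite /= in_itv /= pmin ?qmax // inE.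
  rewrite -ler_pdivlMl // -lee_fin (le_trans xvol) //.
  by rewrite EFinM lee_wpmul2l // lee_fin.
split; first by exists p.
have pq : f p <= f q.
  by rewrite -subr_ge0; apply: le_trans xpq; rewrite mulr_ge0.
apply: (@le_trans _ _ ((2^-1)%:E * (f q - f p)%:E)%E).
  by rewrite -EFinM lee_fin -ler_pdivrMl ?invrK.
rewrite lee_wpmul2l // ?lee_fin // -lebesgue_measure_segment //.
apply: lebesgue_measure_le => //.
  by apply: compact_measurable; exact: continuous_compact.
move=> t /=; rewrite in_itv /= => /andP[pt tq].
pose l := (t - f p) / (f q - f p).
have [epq|npq] := eqVneq (f p) (f q).
  exists p; first by split=> //; apply/fiberE.
  by apply/eqP; rewrite eq_le pt epq tq.
have d0 : 0 < f q - f p by rewrite subr_gt0 lt_neqAle npq.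
have l01 : 0 <= l <= 1.
  by rewrite divr_ge0 ?subr_ge0 //= ler_pdivrMr // mul1r lerD2r.
exists ((1 - l) *: p + l *: q).
  split; first exact: convex_combination.
  move/eq_proj : px => px; move/eq_proj : qx => qx.
  apply/fiberE/eq_proj => i im.
  by rewrite !mxE px // qx //; ring.
by rewrite /f !mxE -/(f p) -/(f q) /l; field; exact: lt0r_neq0.
Qed.

Lemma steiner_shrink x y : steiner K x -> proj y = proj x ->
  `|y 0 ord_max| <= `|x 0 ord_max| -> steiner K y.
Proof.
rewrite /steiner /= => -[Px vx] yx yxn; rewrite yx; split=> //.
by apply: le_trans vx; rewrite lee_fin !inner_e_last.
Qed.

Lemma steiner_proj x : x 0 ord_max = 0 -> steiner K x <-> (proj @` K) x.
Proof.
move=> x0; have xx : proj x = x by rewrite [RHS]proj_add_last x0 scale0r addr0.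
split; first by case; rewrite xx.
move=> Kx; split; first by rewrite xx.
rewrite inner_e_last x0 normr0 mule_ge0 //.
Qed.

Lemma steiner_convex x y (t : R) : 0 <= t <= 1 -> steiner K x -> steiner K y ->
  steiner K ((1 - t) *: x + t *: y).
Proof.
move=> t01; have /andP[t0 t1] := t01.
move=> /steinerP[p [q [Kp Kq /eq_proj px /eq_proj qx xpq]]].
move=> /steinerP[p' [q' [Kp' Kq' /eq_proj py /eq_proj qy ypq]]].
apply/steinerP; exists ((1 - t) *: p + t *: p'), ((1 - t) *: q + t *: q'); split.
- exact: convex_combination.
- exact: convex_combination.
- by apply/eq_proj => i im; rewrite !mxE px // py.
- by apply/eq_proj => i im; rewrite !mxE qx // qy.
rewrite !mxE; have t1' : 0 <= 1 - t by rewrite subr_ge0.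
apply: (@le_trans _ _ (2 * ((1 - t) * `|x 0 ord_max| + t * `|y 0 ord_max|))).
  rewrite ler_pM2l // (le_trans (ler_normD _ _)) // !normrM (ger0_norm t0).
  by rewrite (ger0_norm t1').
have := ler_wpM2l t1' xpq; have := ler_wpM2l t0 ypq; lra.
Qed.

Lemma coord_bound : exists2 r : R, 0 < r &
  forall x, K x -> forall i, `|x 0 i| <= r.
Proof.
have /pinfty_ex_gt0[r r0 hr] := compact_bounded cK.
exists r => // x Kx i; apply: le_trans (hr _ Kx).
rewrite [leRHS]mx_normrE; exact: (le_bigmax _ (fun ij : 'I_1 * 'I_n.+1 => `|x ij.1 ij.2|) (0, i)).
Qed.

Lemma steiner_bound (r : R) : (forall x, K x -> forall i, `|x 0 i| <= r) ->
  forall x, steiner K x -> forall i, `|x 0 i| <= r.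
Proof.
move=> Kr x /steinerP[p [q [Kp Kq /eq_proj px /eq_proj qx xpq]]] i.
have [->|im] := eqVneq i ord_max; last by rewrite -px // Kr.
have := Kr _ Kp ord_max; have := Kr _ Kq ord_max.
by rewrite !ler_norml => /andP[? ?] /andP[? ?]; rewrite -ler_norml; lra.
Qed.

End ConvexBody.

(** * Lattice points by height *)

Section LatticePoints.
Variables (R : realType) (n : nat).
Implicit Types (X : set 'rV[R]_n.+1) (s : seq int).

Lemma finite_bounded_lattice X (r : R) :
  (forall x, X x -> forall i, `|x 0 i| <= r) -> finite_set (X `&` lattice R n.+1).
Proof.
move=> Xr; pose N := (Num.truncn r).+1.
pose F (f : {ffun 'I_n.+1 -> 'I_N.*2.+1}) : 'rV[R]_n.+1 := \row_i ((f i)%:R - N%:R).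
apply: (@sub_finite_set _ _ (F @` setT)); last exact/finite_image/finite_finset.
move=> x [/Xr xr lx].
pose f := [ffun i : 'I_n.+1 => inord (Num.truncn (x 0 i + N%:R)) : 'I_N.*2.+1].
exists f => //; apply/rowP => i; rewrite !mxE ffunE.
have xN : - N%:R <= x 0 i <= N%:R.
  rewrite -ler_norml (le_trans (xr i)) // ltW //.
  have r0 : 0 <= r by apply: le_trans (xr i).
  by have /andP[] := truncn_itv r0.
have /natrP[k ek] : x 0 i + N%:R \is a Num.nat.
  rewrite natrEint rpredD ?natr_int ?lx //=; lra.
rewrite ek natrK inordK -?ek ?addrK //.
rewrite ltnS -(ler_nat R) -ek -addnn natrD; lra.
Qed.

(** The lattice point with height t above the integer vector s; only sequences s
of size n are meant. *)
Definition lattice_point s (t : int) : 'rV[R]_n.+1 :=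
  \row_(i < n.+1) (if (i < n)%N then nth 0 s i else t)%:~R.

Lemma lattice_point_last s t : lattice_point s t 0 ord_max = t%:~R.
Proof. by rewrite mxE ltnn. Qed.

Lemma lattice_point_coord s t i : i != ord_max ->
  lattice_point s t 0 i = (nth 0 s i)%:~R /\ (i < n)%N.
Proof.
move=> im; have lin : (i < n)%N by rewrite ltn_neqAle im -ltnS /=.
by rewrite mxE lin.
Qed.

Lemma lattice_point_lattice s t : lattice R n.+1 (lattice_point s t).
Proof. by move=> i; rewrite mxE intr_int. Qed.

Lemma lattice_point_inj t s s' : size s = n -> size s' = n ->
  lattice_point s t = lattice_point s' t -> s = s'.
Proof.
move=> sn s'n /rowP e; apply: (@eq_from_nth _ 0); first by rewrite sn.
rewrite sn => i lin; have := e (widen_ord (leqnSn n) (Ordinal lin)).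
by rewrite !mxE /= lin => /intr_inj.
Qed.

Lemma latticeP x : lattice R n.+1 x -> exists s t, size s = n /\ x = lattice_point s t.
Proof.
move=> lx; exists [seq Num.floor (x 0 (inord i)) | i <- iota 0 n], (Num.floor (x 0 ord_max)).
rewrite size_map size_iota; split=> //; apply/rowP => i; rewrite mxE.
case: ifP => lin; last first.
  rewrite floorK //; congr (x 0 _); apply/val_inj => /=.
  by apply/eqP; rewrite eqn_leq -ltnS ltn_ord leqNgt lin.
by rewrite (nth_map 0%N) ?size_iota // nth_iota // add0n inord_val floorK.
Qed.

Definition slice X (t : int) : {fset seq int} :=
  fset_set [set s | size s = n /\ X (lattice_point s t)].

Lemma finite_slice X t : finite_set (X `&` lattice R n.+1) ->
  finite_set [set s | size s = n /\ X (lattice_point s t)].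
Proof.
move=> fX; pose c (x : 'rV[R]_n.+1) := [seq Num.floor (x 0 (inord i)) | i <- iota 0 n].
apply: (@sub_finite_set _ _ (c @` (X `&` lattice R n.+1))); last exact: finite_image.
move=> s [sn Xs]; exists (lattice_point s t).
  by split=> //; exact: lattice_point_lattice.
apply: (@eq_from_nth _ 0); rewrite size_map size_iota // => i lin.
rewrite (nth_map 0%N) ?size_iota // nth_iota // add0n mxE inordK ?lin ?intrKfloor //.
exact: ltnW.
Qed.

Lemma in_slice X t s : finite_set (X `&` lattice R n.+1) ->
  (s \in slice X t) = `[< size s = n /\ X (lattice_point s t) >].
Proof.
by move=> /(finite_slice t) fX; rewrite in_fset_set //; apply/asboolP/asboolP; rewrite inE.
Qed.

Lemma card_slice X t : finite_set (X `&` lattice R n.+1) ->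
  #|` [fset x in fset_set (X `&` lattice R n.+1) | x 0 ord_max == t%:~R]%fset | = #|` slice X t|.
Proof.
move=> fX.
have inj : {in slice X t &, injective (lattice_point^~ t)}.
  move=> s s'; rewrite !in_slice // => /asboolP[sn _] /asboolP[s'n _].
  exact: lattice_point_inj.
transitivity (#|` [fset lattice_point s t | s in slice X t]%fset|).
  2: exact: card_in_imfset.
congr (#|` _|); apply/fsetP => x.
rewrite !inE in_fset_set //=; apply/andP/imfsetP => /= [[]|[s]].
  rewrite inE => -[Xx /latticeP[s [t' [sn ex]]]] /eqP xt; subst x.
  move: xt; rewrite lattice_point_last => /intr_inj e; subst t'.
  by exists s => //; rewrite in_slice //; apply/asboolP.
rewrite in_slice // => /asboolP[sn Xs] ->; rewrite lattice_point_last eqxx inE.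
by split=> //; split=> //; exact: lattice_point_lattice.
Qed.

Definition flip (x : 'rV[R]_n.+1) : 'rV[R]_n.+1 :=
  x - (2 * x 0 ord_max) *: e_last R n.

Lemma flip_lattice_point s t : flip (lattice_point s t) = lattice_point s (- t).
Proof.
apply/rowP => i; rewrite /flip !mxE eqxx ltnn /=.
have [->|im] := eqVneq i ord_max; first by rewrite ltnn intrN /=; lra.
by rewrite ltn_neqAle im -ltnS ltn_ord mulr0 subr0.
Qed.

Lemma slice_flip X t : (forall x, X x -> X (flip x)) -> slice X (- t) = slice X t.
Proof.
move=> Xf; rewrite /slice; congr (fset_set _); apply/seteqP; split=> s /= [sn /Xf].
  by rewrite flip_lattice_point opprK.
by rewrite flip_lattice_point.
Qed.

(** Above height 0 every level consists of two mirror images of one slice. *)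
Lemma card_level X (k : nat) : finite_set (X `&` lattice R n.+1) ->
  (forall x, X x -> X (flip x)) ->
  (#|` [fset x in fset_set (X `&` lattice R n.+1) | (`|x 0 ord_max| == k%:R)%R]%fset | =
    (0 < k).+1 * #|` slice X k|)%N.
Proof.
move=> fX Xf; set L := fset_set _.
case: (posnP k) => [->|kp].
  by rewrite mul1n -card_slice //; congr (#|` _|); apply/fsetP => x; rewrite !inE normr_eq0.
rewrite mul2n -addnn -{2}(slice_flip _ Xf) -!card_slice // -cardfsUI.
rewrite [X in (_ = _ + X)%N](_ : _ = 0)%N ?addn0.
  congr (#|` _|); apply/fsetP => x; rewrite !inE -andb_orr eqr_norml ler0n andbT.
  by rewrite intrN.
apply/eqP; rewrite cardfs_eq0; apply/eqP/fsetP => x; rewrite !inE.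
apply/negP => /andP[/andP[_ /eqP ->] /andP[_]].
by rewrite intrN -addr_eq0 -mulr2n mulrn_eq0 intr_eq0 eqz_nat (gtn_eqF kp).
Qed.

Lemma sum_levels X (M : nat) (f : nat -> R) : finite_set (X `&` lattice R n.+1) ->
  (forall x, X x -> X (flip x)) ->
  \sum_(x <- fset_set (X `&` lattice R n.+1) | `|x 0 ord_max| <= M%:R)
    f (Num.truncn `|x 0 ord_max|) =
  \sum_(0 <= k < M.+1) f k * ((0 < k).+1 * #|` slice X k|)%:R.
Proof.
move=> fX Xf.
set L := fset_set _; rewrite big_mkord.
under [RHS]eq_bigr => k _ do rewrite -card_level // mulrC -sumr_const_fset_cond big_mkcond.
rewrite exchange_big big_mkcond /=; apply: eq_big_seq => x.
rewrite in_fset_set // inE => -[_ lx].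
have /natrP[j ej] : `|x 0 ord_max| \is a Num.nat by rewrite natr_norm_int.
rewrite ej natrK ler_nat; case: leqP => [jM|Mj].
  have jM' : (j < M.+1)%N by [].
  rewrite (@big_only1 _ _ _ _ (Ordinal jM')) ?eqxx // => k kj _.
  by rewrite eqr_nat; case: eqP => // jk; rewrite -(inj_eq val_inj) /= -jk eqxx in kj.
rewrite big1 // => k _; rewrite eqr_nat gtn_eqF //.
by rewrite (leq_trans (ltn_ord k)).
Qed.

End LatticePoints.

(** * Slices of the symmetral *)

Section SteinerSlices.
Variables (R : realType) (n : nat) (K : set 'rV[R]_n.+1).
Hypothesis (cK : compact K) (vK : convex_set K).
Let S := steiner K.
Let P := proj @` K.
Let SC := minkowski_sum S (cube R n).
Let PC := minkowski_sum P (cube R n).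
Hypothesis (P0 : P 0).

Lemma lattice_finite :
  [/\ finite_set (S `&` lattice R n.+1), finite_set (P `&` lattice R n.+1),
      finite_set (SC `&` lattice R n.+1) & finite_set (PC `&` lattice R n.+1)].
Proof.
have [r r0 Kr] := coord_bound cK.
have Sr := steiner_bound cK vK Kr.
have Pr x : P x -> forall i, `|x 0 i| <= r.
  move=> [k Kk <-] i; rewrite projE; case: ifP => _; last exact: Kr.
  by rewrite normr0 ltW.
have plus_cube (X : set 'rV[R]_n.+1) : (forall x, X x -> forall i, `|x 0 i| <= r) ->
    forall x, minkowski_sum X (cube R n) x -> forall i, `|x 0 i| <= r + 1.
  move=> Xr _ [x Xx [y [yC yn] <-]] i; rewrite mxE (le_trans (ler_normD _ _)) //.
  rewrite lerD ?Xr //; have [->|im] := eqVneq i ord_max; first by rewrite yn normr0.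
  by rewrite ltW // ltr_norml yC.
split.
- exact: finite_bounded_lattice Sr.
- exact: finite_bounded_lattice Pr.
- exact: finite_bounded_lattice (plus_cube _ Sr).
- exact: finite_bounded_lattice (plus_cube _ Pr).
Qed.

Lemma flip_last (x : 'rV[R]_n.+1) : flip x 0 ord_max = - x 0 ord_max.
Proof. by rewrite /flip !mxE !eqxx /=; lra. Qed.

Lemma flip_proj (x : 'rV[R]_n.+1) : proj (flip x) = proj x.
Proof. by apply/eq_proj => i im; rewrite /flip !mxE (negPf im) andbF mulr0 subr0. Qed.

Lemma steiner_flip x : S x -> S (flip x).
Proof.
move=> Sx; apply: steiner_shrink Sx _ _; first exact: flip_proj.
by rewrite flip_last normrN.
Qed.

Lemma steiner_cube_flip x : SC x -> SC (flip x).
Proof.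
move=> [s Ss [c [cC cn] <-]]; exists (flip s); first exact: steiner_flip.
exists c => //; rewrite /flip !mxE cn addr0 -addrA (addrC _ c) addrA //.
Qed.

Definition at_height (x : 'rV[R]_n.+1) (t : R) : 'rV[R]_n.+1 := proj x + t *: e_last R n.

Lemma at_height_last x t : at_height x t 0 ord_max = t.
Proof. by rewrite /at_height mxE projE !mxE !eqxx /= add0r mulr1. Qed.

Lemma at_height_proj x t : proj (at_height x t) = proj x.
Proof.
by apply/eq_proj => i im; rewrite mxE projE !mxE (negPf im) andbF mulr0 addr0.
Qed.

Lemma at_height_lattice x t : lattice R n.+1 x -> t \is a Num.int ->
  lattice R n.+1 (at_height x t).
Proof.
move=> lx ti i; have [->|im] := eqVneq i ord_max; first by rewrite at_height_last.
by have /eq_proj -> := at_height_proj x t.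
Qed.

(** With a point at height k, a fiber of the symmetral contains the whole segment
between the heights - k and k. *)
Lemma card_fiber_ge x (k : nat) : S x -> lattice R n.+1 x -> `|x 0 ord_max| = k%:R ->
  (2 * k + 1 <= G (S `&` fiber (proj x)))%N.
Proof.
move=> Sx lx xk; have [fS _ _ _] := lattice_finite.
pose pt (j : nat) := at_height x (j%:R - k%:R).
have pt_inj : injective pt.
  move=> i j /(congr1 (fun z : 'rV[R]_n.+1 => z 0 ord_max)).
  by rewrite /pt !at_height_last => /addIr/eqP; rewrite eqr_nat => /eqP.
rewrite -(size_iota 0 (2 * k + 1)) -(size_map pt); apply: uniq_leq_size.
  by rewrite map_inj_uniq // iota_uniq.
move=> _ /mapP[j jk ->]; rewrite mem_iota in jk.
rewrite in_fset_set; last by rewrite setIAC; exact: finite_setIl.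
rewrite inE; split; [split|].
- apply: steiner_shrink Sx _ _; first exact: at_height_proj.
  rewrite at_height_last xk ler_norml lerBlDr -natrD ler_nat lerBrDl subrr ler0n /=.
  by lia.
- by apply/fiberE; exact: at_height_proj.
- by apply: at_height_lattice => //; rewrite rpredB // natr_int.
Qed.

Lemma card_axis_le (k : nat) : ~ S (at_height 0 k.+1%:R) ->
  (G (S `&` axis R n) <= 2 * k + 1)%N.
Proof.
move=> nS; have [fS _ _ _] := lattice_finite.
pose pt (j : nat) : 'rV[R]_n.+1 := (j%:R - k%:R) *: e_last R n.
rewrite -[leqRHS](size_iota 0) -(size_map pt); apply: uniq_leq_size => // x.
rewrite in_fset_set; last by rewrite setIAC; exact: finite_setIl.
rewrite inE => -[[Sx [t _ ex]] lx].
have xn : x 0 ord_max = t by rewrite -ex !mxE !eqxx mulr1.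
have tk : `|t| < k.+1%:R.
  rewrite ltNge; apply/negP => kt; apply: nS; apply: steiner_shrink Sx _ _.
    by apply/eq_proj => i im; rewrite -ex !mxE (negPf im) andbF !mulr0 subr0 addr0.
  by rewrite at_height_last xn ger0_norm.
have ti : t \is a Num.int by rewrite -xn.
have tk' : - k%:R <= t <= k%:R.
  rewrite -ler_norml; move: tk.
  have /natrP[j ->] : `|t| \is a Num.nat by rewrite natr_norm_int.
  by rewrite ltr_nat ler_nat ltnS.
have /natrP[j ej] : t + k%:R \is a Num.nat.
  rewrite natrEint rpredD ?natr_int //=; lra.
apply/mapP; exists j; last by rewrite /pt -ej addrK -ex.
rewrite mem_iota /= add0n addn1 ltnS -(ler_nat R) -ej natrM; lra.
Qed.

(** This is where the maximality of the central fiber enters: a lattice point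
higher than M would give a fiber with at least 2 (M + 1) + 1 lattice points,
while the central one has at most 2 M + 1. *)
Lemma exists_height :
  (forall y, P y -> lattice R n.+1 y -> (G (S `&` fiber y) <= G (S `&` axis R n))%N) ->
  exists M : nat, S (at_height 0 M%:R) /\
    forall x, S x -> lattice R n.+1 x -> `|x 0 ord_max| <= M%:R.
Proof.
move=> hmax; have [r r0 Kr] := coord_bound cK.
pose Q k := `[< S (at_height 0 k%:R) >].
have Q0 : exists k, Q k.
  exists 0%N; apply/asboolP/steiner_proj; first by rewrite at_height_last.
  by rewrite /at_height scale0r addr0 /proj inner_e_last mxE scale0r subrr.
have Qr k : Q k -> (k <= Num.truncn r)%N.
  move=> /asboolP/(steiner_bound cK vK Kr)/(_ ord_max).
  by rewrite at_height_last ger0_norm // truncn_ge_nat // ltW.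
have [M /asboolP SM Mmax] := ex_maxnP Q0 Qr.
exists M; split=> // x Sx lx.
have /natrP[k xk] : `|x 0 ord_max| \is a Num.nat by rewrite natr_norm_int.
rewrite xk ler_nat leqNgt; apply/negP => Mk.
have nS : ~ S (at_height 0 M.+1%:R).
  move=> SM1; have /Mmax : Q M.+1 by exact/asboolP.
  by rewrite ltnn.
have Px : P (proj x) by case: Sx.
have lpx : lattice R n.+1 (proj x).
  by move=> i; rewrite projE; case: ifP => // _; rewrite int_num0.
have := leq_trans (card_fiber_ge Sx lx xk) (leq_trans (hmax _ Px lpx) (card_axis_le nS)).
by lia.
Qed.

Lemma in_slice_axis M (k : nat) : S (at_height 0 M%:R) -> (k <= M)%N ->
  nseq n 0 \in slice S k.
Proof.
move=> SM kM; have [fS _ _ _] := lattice_finite.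
rewrite in_slice //; apply/asboolP; rewrite size_nseq; split=> //.
apply: steiner_shrink SM _ _.
  apply/eq_proj => i im; have [-> iN] := lattice_point_coord R (nseq n 0) k im.
  have /eq_proj -> // := at_height_proj 0 M%:R.
  by rewrite nth_nseq iN mxE.
by rewrite at_height_last lattice_point_last !ger0_norm // ?ler_nat // ler0n.
Qed.

Lemma sub_steiner_cube : S `<=` SC.
Proof.
move=> x Sx; exists x => //; exists 0; last by rewrite addr0.
by split=> [i _|]; rewrite mxE // ltrN10 ltr01.
Qed.

Lemma slice_steiner_sub t : (slice S t `<=` slice SC t)%fset.
Proof.
have [fS _ fSC _] := lattice_finite.
apply/fsubsetP => s; rewrite !in_slice // => /asboolP[sn Ss].
by apply/asboolP; split=> //; exact: sub_steiner_cube.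
Qed.

(** By convexity, a mean of points of the slices at heights 0 and k, with weight
i / k on the latter, lies in the slice at height i; adding C reaches the lattice
points near it. *)
Lemma slice_brunn_minkowski M (i k : nat) (v : R) : S (at_height 0 M%:R) ->
  (0 < k <= M)%N -> (i <= k)%N -> 0 <= v ->
  #|` slice S 0|%:R * v ^+ n <= #|` slice S k|%:R ->
  #|` slice S 0|%:R * ((1 - i%:R / k%:R) + i%:R / k%:R * v) ^+ n <= #|` slice SC i|%:R.
Proof.
move=> SM /andP[k0 kM] ik v0 hv; have [fS _ fSC _] := lattice_finite.
have kR : 0 < (k%:R : R) by rewrite ltr0n.
set lam := i%:R / k%:R.
have l01 : 0 <= lam <= 1.
  by rewrite divr_ge0 //= ler_pdivrMr // mul1r ler_nat.
have slice_neq0 j : (j <= M)%N -> slice S j != fset0.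
  by move=> jM; apply/fset0Pn; exists (nseq n 0); exact: (in_slice_axis SM).
have slice_size j a : a \in slice S j -> size a = n.
  by rewrite in_slice // => /asboolP[].
have bm := @brunn_minkowski_lattice R lam n (slice S 0) (slice S k) (slice SC i) l01
  (slice_neq0 0%N (leq0n M)) (slice_neq0 k kM) (slice_size 0) (slice_size k).
have := bm _ #|` slice S 0|%:R 1 v (ler0n _ _) ler01 v0.
rewrite expr1n !mulr1; move/(_ _ (lexx _) hv); apply.
move=> a b z; rewrite !in_slice // => /asboolP[an Sa] /asboolP[bn Sb].
move=> /near_means_nth[sa sb hn]; apply/asboolP; rewrite -sa; split=> //.
have Sab := steiner_convex cK vK l01 Sa Sb; set x := _ + _ in Sab.
exists x => //; exists (lattice_point R n z i - x); last by rewrite addrC subrK.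
split.
  move=> j jm.
  have [za jn] := lattice_point_coord R z i jm.
  have := hn j; rewrite -sa an => /(_ jn); rewrite /near_mean ltr_norml.
  have [aa _] := lattice_point_coord R a 0 jm; have [bb _] := lattice_point_coord R b k jm.
  by rewrite !mxE /= jn.
rewrite mxE lattice_point_last mxE /x !mxE ltnn mulr0 add0r -!pmulrn /lam.
by rewrite divfK ?subrr // lt0r_neq0.
Qed.

Lemma card_proj_slice : G P = #|` slice S 0|.
Proof.
have [fS fP _ _] := lattice_finite; rewrite -card_slice //.
congr (#|` _|); apply/fsetP => x; rewrite !inE !in_fset_set //.
have P_last : P x -> x 0 ord_max = 0.
  by move=> [k _ <-]; rewrite projE eqxx.
apply/idP/andP; rewrite !inE.
  move=> [Px lx]; have x0 := P_last Px; rewrite x0; split=> //; split=> //.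
  exact/steiner_proj.
by move=> [[Sx lx] /eqP x0]; split=> //; exact/steiner_proj.
Qed.

Lemma slice_card_proj_cube : (#|` slice SC 0| <= G PC)%N.
Proof.
have [fS fP fSC fPC] := lattice_finite; rewrite -card_slice //.
apply: fsubset_leq_card; apply/fsubsetP => x; rewrite !inE !in_fset_set //.
move=> /andP[]; rewrite !inE => -[[s Ss [c [cC cn] <-]] lx] /eqP.
rewrite mxE cn addr0 => s0; split=> //; exists s; first exact/steiner_proj.
by exists c.
Qed.

Lemma lattice_integral_slices M :
  (forall x, S x -> lattice R n.+1 x -> `|x 0 ord_max| <= M%:R) ->
  lattice_integral S (fun x => `|inner x (e_last R n)| ^+ n.+1) =
  2 * \sum_(0 <= k < M.+1) k%:R ^+ n.+1 * #|` slice S k|%:R.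
Proof.
move=> hM; have [fS _ _ _] := lattice_finite.
rewrite /lattice_integral fsbig_finite //=.
transitivity (\sum_(x <- fset_set (S `&` lattice R n.+1) | `|x 0 ord_max| <= M%:R)
    ((Num.truncn `|x 0 ord_max|)%:R : R) ^+ n.+1).
  rewrite [RHS]big_mkcond; apply: eq_big_seq => x.
  rewrite in_fset_set // inE inner_e_last => -[Sx lx]; rewrite hM //.
  have /natrP[j ->] : `|x 0 ord_max| \is a Num.nat by rewrite natr_norm_int.
  by rewrite natrK.
rewrite (sum_levels M (fun k => k%:R ^+ n.+1) fS steiner_flip) mulr_sumr.
apply: eq_bigr => -[|k] _; first by rewrite expr0n mul0r mul0r mulr0.
by rewrite natrM mulrCA.
Qed.

(** The slice at height 0 has no mirror image in S + C, and the enumerator of the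
projection stands in for it. *)
Lemma lattice_enumerator_ge M :
  2 * \sum_(0 <= k < M.+1) #|` slice SC k|%:R <= (G SC + G PC)%:R :> R.
Proof.
have [_ _ fSC _] := lattice_finite.
have := sum_levels M (fun=> 1 : R) fSC steiner_cube_flip.
rewrite sumr_const_fset_cond mulr1 => eS.
apply: (@le_trans _ _ (\sum_(0 <= k < M.+1) 1 * ((0 < k).+1 * #|` slice SC k|)%:R
    + #|` slice SC 0|%:R)).
  rewrite !big_nat_recl //= mulrDr mul1r mul1n addrAC mulr_sumr lerD //.
    by rewrite mulr_natl mulr2n.
  by apply: ler_sum => k _; rewrite mul1r natrM.
rewrite -eS natrD lerD // ler_nat ?slice_card_proj_cube //.
by apply: fsubset_leq_card; apply/fsubsetP => x; rewrite !inE => /andP[].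
Qed.

End SteinerSlices.

Theorem theorem1p7 (R : realType) (n : nat) (K : set 'rV[R]_n.+1)
  (hK : convex_body K)
  (h0 : (proj @` K) 0)
  (hmax : is_max
    [set G (steiner K `&` fiber y) | y in (proj @` K) `&` lattice R n.+1]
    (G (steiner K `&` axis R n))) :
  exists M : R,
    is_max [set inner x (e_last R n) | x in steiner K `&` lattice R n.+1] M /\
    exists m0 : R,
      [/\ M <= m0,
          1 < m0 &
          n.+2%:R * (B n.+1 m0 n.+2%:R)^-1 / (B n.+1 m0 1) ^- n.+2 * 2 ^+ n.+1
            * lattice_integral (steiner K)
                (fun x => `|inner x (e_last R n)| ^+ n.+1)
          <= (G (minkowski_sum (steiner K) (cube R n))
              + G (minkowski_sum (proj @` K) (cube R n)))%:R ^+ n.+2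
             / (G (proj @` K))%:R ^+ n.+1].
Proof.
have [cK vK _] := hK.
have [|M [SM hM]] := exists_height cK vK h0.
  by move=> y Py ly; apply: hmax.2; exists y.
exists M%:R; split.
  split; last first.
    by move=> _ [x [Sx lx] <-]; rewrite inner_e_last (le_trans (ler_norm _)) // hM.
  exists (at_height 0 M%:R); last by rewrite inner_e_last at_height_last.
  split=> //; apply: at_height_lattice; last exact: natr_int.
  by move=> i; rewrite mxE int_num0.
rewrite (lattice_integral_slices cK vK hM) (card_proj_slice cK vK).
have slice_pos k : (k <= M)%N -> 0 < (#|` slice (steiner K) k|%:R : R).
  move=> kM; rewrite ltr0n cardfs_gt0; apply/fset0Pn; exists (nseq n 0).
  exact: (in_slice_axis cK vK SM kM).
have [fS _ _ _] := lattice_finite cK vK.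
apply: (@discrete_berwald R n M (fun k => #|` slice (steiner K) k|%:R)
  (fun k => #|` slice (minkowski_sum (steiner K) (cube R n)) k|%:R)).
- move=> k kM; rewrite slice_pos //= ler_nat.
  by apply: fsubset_leq_card; exact: slice_steiner_sub.
- (* in dimension one a slice is empty or a single point *)
  have slice1 k : n = 0%N -> (k <= M)%N -> #|` slice (steiner K) k| = 1%N.
    move=> n0 kM; apply/eqP; rewrite eqn_leq -(ltr0n R) slice_pos // andbT.
    rewrite -(cardfs1 ([::] : seq int)); apply: fsubset_leq_card; apply/fsubsetP => s.
    by rewrite in_slice // => /asboolP[sn _]; rewrite inE -size_eq0 sn; apply/eqP.
  move=> n0 k kM; have e := etrans (slice1 k n0 kM) (esym (slice1 0%N n0 (leq0n M))).
  exact: (congr1 (fun c : nat => c%:R : R) e).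
- by move=> i k v kM ik v0; exact: (slice_brunn_minkowski cK vK SM).
- exact: (lattice_enumerator_ge cK vK).
Qed.
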